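(* Let $\mathfrak g$ be a symmetrizable Kac--Moody superalgebra (as in the context), and let $\mathfrak g_{\bar1}=\mathfrak g_{+1}\oplus\mathfrak g_{-1}$ with $\mathfrak g_{+1}=\mathfrak g_{\bar1}\cap\mathfrak n^+$ and $\mathfrak g_{-1}=\mathfrak g_{\bar1}\cap\mathfrak n^-$. Assume that $\mathfrak g_{\pm1}$ are abelian and that the $\mathfrak g_{\bar0}$-action is compatible, that is, $\mathfrak g_{+1}\cong\mathfrak g_{-1}$ as $\mathfrak g_{\bar0}$-modules. Let $M$ be a highest weight $\mathfrak g$-supermodule that is discretely decomposable as a $\mathfrak g_{\bar0}$-module and $\omega$-unitarizable for a consistent conjugate-linear anti-involution $\omega$ with $\omega(x_a)=\partial_a$, $\omega(\partial_a)=x_a$ for all $a$. Then there is an isomorphism of $\mathfrak g_{\bar0}$-modules $$\ker\mathrm D_{\mathfrak g,\mathfrak g_{\bar0}}\cong H^*(\mathfrak g_{+1};M)\otimes\mathbb C_{-\rho_{\bar1}}.$$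
   Context: Kac--Moody superalgebras: for $I=\{1,\dots,n\}$, an $n\times n$ matrix $A=(a_{ij})$ with $a_{ii}\in\{0,2\}$, a parity function $p:I\to\mathbb Z_2$, and $\mathfrak h$ even of dimension $2n-\operatorname{rk}A$ with linearly independent $\alpha_i\in\mathfrak h^*$, $h_i\in\mathfrak h$, $\alpha_j(h_i)=a_{ij}$, let $\mathfrak g(A)$ be the Lie superalgebra generated by $\mathfrak h$ and $X_i,Y_i$ (parity $p(i)$) with $[h,X_i]=\alpha_i(h)X_i$, $[h,Y_i]=-\alpha_i(h)Y_i$, $[X_i,Y_j]=\delta_{ij}h_i$, $[\mathfrak h,\mathfrak h]=0$, modulo the maximal ideal meeting $\mathfrak h$ trivially. It is a Kac--Moody superalgebra if it is quasisimple (every ideal is contained in $\mathfrak h$ or together with $\mathfrak h$ spans), regular ($a_{ij}=0\Rightarrow a_{ji}=0$) and admissible ($a_{ii}=0,p(i)=\bar0\Rightarrow a_{ij}=0\ \forall j$; $a_{ii}=2,p(i)=\bar0\Rightarrow a_{ij}\in\mathbb Z_{\le0}$ for $j\ne i$; $a_{ii}=2,p(i)=\bar1\Rightarrow a_{ij}\in2\mathbb Z_{\le0}$ for $j\neq i$); symmetrizable if $DA$ is symmetric for an invertible diagonal $D=\operatorname{diag}(d_i)$, in which case it has the nondegenerate even supersymmetric invariant standard form $B$ with $B(h,h_j)=d_j\alpha_j(h)$. Standing assumption: $B(\alpha,\beta)\in\mathbb R$ for all simple roots $\alpha,\beta$. Principal grading: $\deg X_i=1$, $\deg Y_i=-1$,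 $\deg\mathfrak h=0$. Triangular decomposition $\mathfrak g=\mathfrak n^-\oplus\mathfrak h\oplus\mathfrak n^+$, root spaces $\mathfrak g^\alpha$. Weyl vector $\rho\in\mathfrak h^*$: $\rho(h_i)=\tfrac12\alpha_i(h_i)$. The Kac--Peterson class of $\mathfrak g_{\bar0}$ is assumed trivial: there is $\rho_{\bar0}\in\mathfrak h^*$ (extended by zero to root spaces) with $\rho_{\bar0}([x,y])=\tfrac12\operatorname{tr}(\mathrm{ad}_x\pi_-\mathrm{ad}_y\pi_+)-\tfrac12\operatorname{tr}(\mathrm{ad}_y\pi_-\mathrm{ad}_x\pi_+)$ on $\mathfrak g_{\bar0}$, where $\pi_+$, resp. $\pi_-$, is the projection of $\mathfrak g_{\bar0}$ onto its part of positive, resp. nonpositive, principal degree. Put $\rho_{\bar1}=\rho_{\bar0}-\rho$ (extended by zero to root spaces); $\mathbb C_{-\rho_{\bar1}}$ is the one-dimensional $\mathfrak g_{\bar0}$-module on which $\mathfrak g_{\bar0}$ acts by $-\rho_{\bar1}$. A conjugate-linear anti-involution is a conjugate-linear $\omega:\mathfrak g\to\mathfrak g$ with $\omega^2=\mathrm{id}$, $\omega([x,y])=[\omega(y),\omega(x)]$; consistent: $\omega(\mathfrak g^\alpha)=\mathfrak g^{-\alpha}$ for all roots. Highest weight supermodule of highest weight $\Lambda$: $\mathfrak h$-weight supermodule with finite-dimensional weight spaces generated by a nonzero vector $v_\Lambda$ of weight $\Lambda$ with $\mathfrak n^+v_\Lambda=0$. With $\Lambda(h)=\overline{\Lambda(\omega(h))}$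 for $h\in\mathfrak h$ (assumed), $M$ has a unique Hermitian form with $\langle v_\Lambda,v_\Lambda\rangle=1$, $\langle xv,w\rangle=\langle v,\omega(x)w\rangle$ for $x\in\mathfrak g$; $M$ is $\omega$-unitarizable if it is positive definite. Discretely decomposable over $\mathfrak g_{\bar0}$: an algebraic direct sum of simple highest weight $\mathfrak g_{\bar0}$-modules. Oscillator module: $(x_a)$, $(\partial_a)$ are homogeneous bases of $\mathfrak g_{-1}$, $\mathfrak g_{+1}$ with $B(\partial_a,x_b)=\tfrac12\delta_{ab}$. The Clifford (Weyl) algebra $\mathrm{Cl}(\mathfrak g_{\bar1})$ (relations $xy-yx=2B(x,y)$) acts on $M(\mathfrak g_{\bar1})=S(\mathfrak g_{-1})=\mathbb C[x_1,x_2,\dots]$, $x_a$ by multiplication, $\partial_a$ by $\partial/\partial x_a$. An element $x\in\mathfrak g_{\bar0}$ acts on $M(\mathfrak g_{\bar1})$ by $\pi(x)=\tfrac12\sum_a{:}[x,x_a]\partial_a{:}-\tfrac12\sum_a{:}[x,\partial_a]x_a{:}-\rho_{\bar1}(x)$, where ${:}\ {:}$ places elements of $\mathfrak g_{-1}$ to the left of those of $\mathfrak g_{+1}$; on $\mathfrak h$ this is the adjoint action shifted by $-\rho_{\bar1}$. $\mathfrak g_{\bar0}$ acts diagonally on $M\otimes M(\mathfrak g_{\bar1})$. The relative Dirac operator is $\mathrm D_{\mathfrak g,\mathfrak g_{\bar0}}=2\sum_a(x_a\otimes\partial_a-\partial_a\otimes x_a)$ acting on $M\otimes M(\mathfrak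 g_{\bar1})$, with $(y\otimes z)(v\otimes P)=(-1)^{p(v)}yv\otimes zP$ for $y,z\in\mathfrak g_{\bar1}$; it commutes with $\mathfrak g_{\bar0}$. Cohomology: $C^*(\mathfrak g_{+1};M)=\bigoplus_iM\otimes S^i(\mathfrak g_{-1})$ with differential $d=\sum_a\partial_a\otimes x_a$ (same sign convention), $d^2=0$, and the natural $\mathfrak g_{\bar0}$-action, with which $d$ commutes; $H^*(\mathfrak g_{+1};M)=\ker d/\operatorname{im}d$, a $\mathfrak g_{\bar0}$-module. *)

(* Defs.v *)
From HB Require Import structures.
From mathcomp Require Import all_boot all_order all_algebra.
From mathcomp Require Import generic_quotient ring_quotient.
From mathcomp Require Import finmap.
From mathcomp Require Import boolp classical_sets functions fsbigop reals.
From mathcomp Require Import complex.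
From mathcomp Require Import monalg.

Set Implicit Arguments.
Unset Strict Implicit.
Unset Printing Implicit Defensive.

Import Order.TTheory GRing.Theory Num.Theory.

Local Open Scope classical_set_scope.
Local Open Scope ring_scope.

Section LinearAlgebra.
Variable K : fieldType.

Definition subspace (V : lmodType K) (S : set V) : Prop :=
  S 0 /\ forall (a : K) u v, S u -> S v -> S (a *: u + v).

Definition bilin (U V W : lmodType K) (f : U -> V -> W) : Prop :=
  (forall v, linear (f^~ v)) /\ (forall u, linear (f u)).

Definition is_basis (V : lmodType K) (S : set V) (J : choiceType) (e : J -> V) :
    Prop :=
  [/\ forall a, S (e a),
      forall (s : seq J) (c : J -> K), uniq s ->
        \sum_(a <- s) c a *: e a = 0 -> forall a, a \in s -> c a = 0
    & forall v, S v ->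
        exists (s : seq J) (c : J -> K), v = \sum_(a <- s) c a *: e a].

(* The trace of an operator of finite rank, which makes sense in any dimension:
   if F = \sum_i f_i(-) e_i then tr F = \sum_i f_i(e_i). *)
Definition has_trace (V : lmodType K) (F : V -> V) (t : K) : Prop :=
  exists (k : nat) (e : 'I_k -> V) (f : 'I_k -> {linear V -> K^o}),
    (forall v, F v = \sum_(i < k) f i v *: e i) /\ t = \sum_(i < k) f i (e i).

Record tensorProduct (V W : lmodType K) := TensorProduct {
  tensor_sort :> lmodType K;
  tens : V -> W -> tensor_sort;
  tens_bilin : bilin tens;
  tens_lift : forall (U : lmodType K) (f : V -> W -> U), bilin f ->
    exists phi : {linear tensor_sort -> U}, forall v w, phi (tens v w) = f v w;
  tens_uniq : forall (U : lmodType K) (phi psi : {linear tensor_sort -> U}),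
    (forall v w, phi (tens v w) = psi (tens v w)) -> phi =1 psi
}.

End LinearAlgebra.

Section Kernel.
Variables (K : fieldType) (V W : lmodType K) (f : {linear V -> W}).

Definition ker_pred : {pred V} := fun v => f v == 0.

Fact ker_pred_submod : submod_closed ker_pred.
Proof.
split; first by rewrite unfold_in linear0.
move=> a u v; rewrite !unfold_in => /eqP fu /eqP fv.
by rewrite linearP fu fv scaler0 addr0.
Qed.
HB.instance Definition _ := GRing.isSubmodClosed.Build K V ker_pred ker_pred_submod.

Record kernel : Type := Kernel { ker_val : V; ker_valP : ker_val \in ker_pred }.
HB.instance Definition _ := [isSub for ker_val].
HB.instance Definition _ := [Choice of kernel by <:].
HB.instance Definition _ := [SubChoice_isSubLmodule of kernel by <:].

End Kernel.

Section Cohomology.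
Variables (K : fieldType) (V : lmodType K) (d : {linear V -> V}).

Definition boundary : {pred kernel d} := fun z => `[< exists t, d t = ker_val z >].

Fact boundary_submod : submod_closed boundary.
Proof.
split; first by rewrite unfold_in; apply/asboolP; exists 0; rewrite linear0.
move=> a u v; rewrite !unfold_in => /asboolP [s es] /asboolP [t et].
by apply/asboolP; exists (a *: s + t); rewrite linearP es et.
Qed.
HB.instance Definition _ :=
  GRing.isSubmodClosed.Build K (kernel d) boundary boundary_submod.

(* ker d / (im d \cap ker d), which is ker d / im d when d^2 = 0 *)
Definition cohomology : Type := Quotient.quot boundary.
HB.instance Definition _ := Choice.on cohomology.
HB.instance Definition _ := GRing.Zmodule.on cohomology.

Definition coclass (z : kernel d) : cohomology :=
  (\pi_(Quotient.quot boundary) z)%qT.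

Lemma coclass_eq (y z : kernel d) :
  (coclass y = coclass z) <-> exists t, d t = ker_val y - ker_val z.
Proof.
rewrite -[_ - _]/(ker_val (y - z)); split=> [/eqP|yz].
  by rewrite -Quotient.idealrBE unfold_in => /asboolP.
by apply/eqP; rewrite -Quotient.idealrBE unfold_in; apply/asboolP.
Qed.

Definition coscale (a : K) (c : cohomology) : cohomology := coclass (a *: repr c).

Lemma coscaleE a z : coscale a (coclass z) = coclass (a *: z).
Proof.
rewrite /coscale; apply/coclass_eq.
have /coclass_eq [t dt] : coclass (repr (coclass z)) = coclass z by exact: reprK.
by exists (a *: t); rewrite linearZ dt /= scalerBr.
Qed.

Lemma coclassD y z : coclass (y + z) = coclass y + coclass z.
Proof. exact: (raddfD (\pi_(Quotient.quot boundary))%qT). Qed.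

Lemma coclassP (c : cohomology) : exists z, c = coclass z.
Proof. by exists (repr c); rewrite /coclass reprK. Qed.

Fact coscaleA a b c : coscale a (coscale b c) = coscale (a * b) c.
Proof. by case: (coclassP c) => z ->; rewrite !coscaleE scalerA. Qed.

Fact coscale1 : left_id 1 coscale.
Proof. by move=> c; case: (coclassP c) => z ->; rewrite coscaleE scale1r. Qed.

Fact coscaleDr : right_distributive coscale +%R.
Proof.
move=> a b c; case: (coclassP b) (coclassP c) => [y ->] [z ->].
by rewrite -coclassD !coscaleE scalerDr coclassD.
Qed.

Fact coscaleDl c : {morph coscale^~ c : a b / a + b}.
Proof.
by move=> a b; case: (coclassP c) => z ->; rewrite !coscaleE scalerDl coclassD.
Qed.

HB.instance Definition _ := GRing.Zmodule_isLmodule.Build K cohomology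
  coscaleA coscale1 coscaleDr coscaleDl.

End Cohomology.

Section Super.
Variable R : realType.
Local Notation C := R[i].

(* The Z/2-grading is given by the projection onto the even part. *)
Record superSpace := SuperSpace {
  super_sort :> lmodType C;
  evpart : {linear super_sort -> super_sort};
  evpart_idem : forall v, evpart (evpart v) = evpart v
}.
Arguments evpart {s}.

Definition parity (V : superSpace) (b : bool) : set V :=
  [set v : V | evpart v = if b then 0 else v].

(* v |-> (-1)^{p(v)} v *)
Definition psign (V : superSpace) (v : V) : V := evpart v *+ 2 - v.

Record lieSuper := LieSuper {
  lie_space :> superSpace;
  br : lie_space -> lie_space -> lie_space;
  br_bilin : bilin br;
  br_parity : forall a b x y,
    parity a x -> parity b y -> parity (a (+) b) (br x y);
  br_skew : forall (a b : bool) x y, parity a x -> parity b y ->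
    br x y = - ((-1) ^+ (a && b) *: br y x);
  br_jacobi : forall (a b : bool) x y z, parity a x -> parity b y ->
    br x (br y z) = br (br x y) z + (-1) ^+ (a && b) *: br y (br x z)
}.

Record superModule (g : lieSuper) := SuperModule {
  mod_space :> superSpace;
  act : g -> mod_space -> mod_space;
  act_bilin : bilin act;
  act_parity : forall a b x v,
    parity a x -> parity b v -> parity (a (+) b) (act x v);
  act_br : forall (a b : bool) x y v, parity a x -> parity b y ->
    act (br x y) v = act x (act y v) - (-1) ^+ (a && b) *: act y (act x v)
}.

Definition lie_hom (g g' : lieSuper) (f : {linear g -> g'}) : Prop :=
  (forall x, f (evpart x) = evpart (f x)) /\
  (forall x y, f (br x y) = br (f x) (f y)).

Definition ideal (g : lieSuper) (I : set g) : Prop :=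
  [/\ subspace I, forall x, I x -> I (evpart x) & forall x y, I y -> I (br x y)].

Definition generated (g : lieSuper) (S : set g) : set g :=
  [set x : g | forall T : set g, subspace T ->
     (forall y z, T y -> T z -> T (br y z)) -> S `<=` T -> T x].

Definition abelian_set (g : lieSuper) (S : set g) : Prop :=
  forall x y, S x -> S y -> br x y = 0.

Record cartanDatum := CartanDatum {
  rank_ : nat;
  cmat : 'M[C]_rank_;
  par : 'I_rank_ -> bool;
  cartan : vectType C;
  sroot : 'I_rank_ -> 'Hom(cartan, C^o);
  coroot : 'I_rank_ -> cartan;
  cmat_diag : forall i, cmat i i = 0 \/ cmat i i = 2;
  cartan_dim : \dim (fullv : {vspace cartan}) = (2 * rank_ - \rank cmat)%N;
  sroot_free : free (codom sroot);
  coroot_free : free (codom coroot);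
  sroot_coroot : forall i j, sroot j (coroot i) = cmat i j
}.

Section KacMoody.
Variable G : cartanDatum.
Local Notation n := (rank_ G).
Local Notation h := (cartan G).
Local Notation A := (cmat G).
Local Notation p := (@par G).

Definition weight := 'Hom(h, C^o).

Record generators (g : lieSuper) := Generators {
  hin : {linear h -> g};
  gX : 'I_n -> g;
  gY : 'I_n -> g
}.

Definition chevalley_relations (g : lieSuper) (e : generators g) : Prop :=
  [/\ forall t, parity false (hin e t),
      forall i, parity (p i) (gX e i) /\ parity (p i) (gY e i),
      forall t i, br (hin e t) (gX e i) = sroot i t *: gX e i /\
                  br (hin e t) (gY e i) = - (sroot i t *: gY e i),
      forall i j, br (gX e i) (gY e j) = if i == j then hin e (coroot i) else 0
    & forall s t, br (hin e s) (hin e t) = 0].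

Definition generating (g : lieSuper) (e : generators g) : Prop :=
  generated (range (hin e) `|` range (gX e) `|` range (gY e)) = setT.

Definition gen_hom (g g' : lieSuper) (e : generators g) (e' : generators g')
    (f : {linear g -> g'}) : Prop :=
  [/\ lie_hom f, forall t, f (hin e t) = hin e' t
    & forall i, f (gX e i) = gX e' i /\ f (gY e i) = gY e' i].

(* g is the Lie superalgebra generated by h, X_i, Y_i with the Chevalley
   relations as defining relations *)
Definition presented (g : lieSuper) (e : generators g) : Prop :=
  [/\ chevalley_relations e, generating e
    & forall (g' : lieSuper) (e' : generators g'), chevalley_relations e' ->
        exists f : {linear g -> g'}, gen_hom e e' f].

Definition meets_cartan_trivially (g : lieSuper) (e : generators g) (I : set g) :
    Prop :=
  forall t, I (hin e t) -> hin e t = 0.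

(* g = g(A): the quotient of the presented superalgebra by its maximal ideal
   meeting h trivially *)
Definition contragredient (g : lieSuper) (e : generators g) : Prop :=
  injective (hin e) /\
  exists (gt : lieSuper) (et : generators gt) (q : {linear gt -> g}),
    [/\ presented et, gen_hom et e q, range q = setT,
        meets_cartan_trivially et [set x : gt | q x = 0]
      & forall I : set gt, ideal I -> meets_cartan_trivially et I ->
          I `<=` [set x : gt | q x = 0]].

Definition quasisimple (g : lieSuper) (e : generators g) : Prop :=
  forall I : set g, ideal I ->
    I `<=` range (hin e) \/ (forall x, exists y t, I y /\ x = y + hin e t).

Definition regular : Prop := forall i j, A i j = 0 -> A j i = 0.

Definition admissible : Prop :=
  [/\ forall i, A i i = 0 -> p i = false -> forall j, A i j = 0,
      forall i, A i i = 2 -> p i = false ->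
        forall j, j != i -> exists k : nat, A i j = - k%:R
    & forall i, A i i = 2 -> p i = true ->
        forall j, j != i -> exists k : nat, A i j = - (2 * k)%:R].

Definition kac_moody (g : lieSuper) (e : generators g) : Prop :=
  [/\ contragredient e, quasisimple e, regular & admissible].

Section Structure.
Variables (g : lieSuper) (e : generators g).

Definition root_space (a : weight) : set g :=
  [set x : g | forall t, br (hin e t) x = a t *: x].

Definition is_root (a : weight) : Prop :=
  a != 0 /\ exists2 x, root_space a x & x != 0.

Definition npos : set g := generated (range (gX e)).
Definition nneg : set g := generated (range (gY e)).

Definition gbar0 : set g := parity false.
Definition gplus : set g := parity true `&` npos.
Definition gminus : set g := parity true `&` nneg.

(* the component of degree k of the principal grading: the least family of
   subspaces compatible with the bracket and the degrees of the generators *)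
Definition principal (k : int) : set g :=
  [set x : g | forall T : int -> set g,
     (forall j, subspace (T j)) ->
     (forall j l y z, T j y -> T l z -> T (j + l) (br y z)) ->
     (forall t, T 0 (hin e t)) ->
     (forall i, T 1 (gX e i) /\ T (-1) (gY e i)) ->
     T k x].

(* With D A symmetric, invariance gives B(h, h_j) = B(X_j, Y_j) alpha_j(h), so
   that the symmetry of B on h requires the normalization
   B(h, h_j) = d_j^-1 alpha_j(h). *)
Definition symmetrizer (d : 'I_n -> C) : Prop :=
  (forall i, d i != 0) /\ (forall i j, d i * A i j = d j * A j i).

Record standard_form (d : 'I_n -> C) (B : g -> g -> C) : Prop := StandardForm {
  form_bilin : bilin (B : g -> g -> C^o);
  form_even : forall a b x y, parity a x -> parity b y -> a != b -> B x y = 0;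
  form_sym : forall (a b : bool) x y, parity a x -> parity b y ->
    B x y = (-1) ^+ (a && b) * B y x;
  form_inv : forall x y z, B (br x y) z = B x (br y z);
  form_nondeg : forall x, (forall y, B x y = 0) -> x = 0;
  form_coroot : forall t j, B (hin e t) (hin e (coroot j)) = (d j)^-1 * sroot j t
}.

(* B(alpha_i, alpha_j) is real, for the form transported to h^* by
   h -> h^*, s |-> B(-, s) *)
Definition real_on_simple_roots (B : g -> g -> C) : Prop :=
  forall i j s t,
    (forall u, B (hin e u) (hin e s) = sroot i u) ->
    (forall u, B (hin e u) (hin e t) = sroot j u) ->
    B (hin e s) (hin e t) \is Num.real.

Definition cartan_projection (ph : {linear g -> h}) : Prop :=
  (forall t, ph (hin e t) = t) /\
  (forall a x, is_root a -> root_space a x -> ph x = 0).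

Definition extend0 (ph : {linear g -> h}) (la : weight) (x : g) : C := la (ph x).

Definition weyl_vector (rho : weight) : Prop :=
  forall i, rho (coroot i) = 2^-1 * sroot i (coroot i).

(* pip and pim extend pi_+ and pi_- by zero on g_1, so that the traces below are
   those of the operators on g_0 *)
Definition kac_peterson (ph : {linear g -> h}) (rho0 : weight) : Prop :=
  exists pip pim : {linear g -> g},
    [/\ forall x, parity true x -> pip x = 0 /\ pim x = 0,
        forall k x, parity false x -> principal k x ->
          pip x = (if 0 < k then x else 0) /\ pim x = (if 0 < k then 0 else x)
      & forall x y, gbar0 x -> gbar0 y -> exists t1 t2 : C,
          [/\ has_trace (fun z => br x (pim (br y (pip z)))) t1,
              has_trace (fun z => br y (pim (br x (pip z)))) t2
            & extend0 ph rho0 (br x y) = 2^-1 * t1 - 2^-1 * t2]].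

Definition g0_stable (S : set g) : Prop :=
  forall x y, gbar0 x -> S y -> S (br x y).

Definition g0_iso (S S' : set g) : Prop :=
  exists phi : {linear g -> g},
    [/\ set_bij S S' phi
      & forall x y, gbar0 x -> S y -> phi (br x y) = br x (phi y)].

(* S is g_0-isomorphic to the (restricted) dual of S' *)
Definition g0_dual (S S' : set g) : Prop :=
  exists b : g -> g -> C,
    [/\ bilin (b : g -> g -> C^o),
        forall x y z, gbar0 x -> S y -> S' z -> b (br x y) z = - b y (br x z),
        forall y, S y -> (forall z, S' z -> b y z = 0) -> y = 0
      & forall z, S' z -> (forall y, S y -> b y z = 0) -> z = 0].

(* h acts on g_{+1} by positive roots and on g_{-1} by negative ones, so that
   g_{+1} and g_{-1} are isomorphic on the nose only if both vanish. The
   isomorphism is therefore allowed to be one up to duality, as is the case for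
   the identification of g_{+1} with the dual of g_{-1} given by B. *)
Definition compatible : Prop :=
  [/\ g0_stable gplus, g0_stable gminus
    & g0_iso gplus gminus \/ g0_dual gplus gminus].

Definition anti_involution (om : g -> g) : Prop :=
  [/\ forall (a : C) x y, om (a *: x + y) = a^* *: om x + om y,
      forall x, om (om x) = x
    & forall x y, om (br x y) = br (om y) (om x)].

Definition consistent (om : g -> g) : Prop :=
  forall a, is_root a -> om @` root_space a = root_space (- a).

Section Modules.
Variable M : superModule g.

Definition has_weight (mu : weight) : set M :=
  [set v : M | forall t, act (hin e t) v = mu t *: v].

Definition stable_under (S : set g) (N : set M) : Prop :=
  forall x v, S x -> N v -> N (act x v).

(* N is a highest weight module of highest weight La and highest weight vector v
   over the subalgebra S; it is used with S = g and S = g_0 *)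
Record highest_weight (S : set g) (N : set M) (La : weight) (v : M) : Prop :=
  HighestWeight {
  hw_subspace : subspace N;
  hw_stable : stable_under S N;
  hw_vector : [/\ N v, v != 0, has_weight La v
                & forall x, S x -> npos x -> act x v = 0];
  hw_generated : forall N' : set M,
    subspace N' -> stable_under S N' -> N' v -> N `<=` N';
  hw_weights : forall u, N u -> exists (k : nat) (mu : 'I_k -> weight) (w : 'I_k -> M),
    (forall i, N (w i) /\ has_weight (mu i) (w i)) /\ u = \sum_(i < k) w i;
  hw_findim : forall mu, exists (k : nat) (w : 'I_k -> M),
    forall u, N u -> has_weight mu u ->
      exists c : 'I_k -> C, u = \sum_(i < k) c i *: w i
}.

Definition simple_under (S : set g) (N : set M) : Prop :=
  (exists2 u, N u & u != 0) /\
  forall N' : set M, subspace N' -> stable_under S N' -> N' `<=` N ->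
    N' = [set 0] \/ N' = N.

Definition direct_sum (I : choiceType) (N : I -> set M) : Prop :=
  (forall u, exists (s : seq I) (w : I -> M),
     (forall i, N i (w i)) /\ u = \sum_(i <- s) w i) /\
  (forall (s : seq I) (w : I -> M), uniq s -> (forall i, N i (w i)) ->
     \sum_(i <- s) w i = 0 -> forall i, i \in s -> w i = 0).

Definition discretely_decomposable : Prop :=
  exists (I : choiceType) (N : I -> set M),
    direct_sum N /\
    forall i, simple_under gbar0 (N i) /\
              exists La v, highest_weight gbar0 (N i) La v.

Definition hermitian_form (om : g -> g) (v0 : M) (H : M -> M -> C) : Prop :=
  [/\ forall w, linear (H^~ w : M -> C^o),
      forall v w, H w v = (H v w)^*,
      H v0 v0 = 1
    & forall x v w, H (act x v) w = H v (act (om x) w)].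

Definition unitarizable (om : g -> g) (v0 : M) : Prop :=
  exists2 H, hermitian_form om v0 H & forall v, v != 0 -> 0 < H v v.

End Modules.

Definition real_weight (om : g -> g) (La : weight) : Prop :=
  forall t, exists2 s, om (hin e t) = hin e s & La t = (La s)^*.

End Structure.

Section Oscillator.
Variables (J : choiceType).

(* C[x_a | a \in J] *)
Definition oscillator := {malg C[{cmonom J}]}.
HB.instance Definition _ := GRing.ComAlgebra.on oscillator.

Definition xvar (a : J) : oscillator := mkmalgU (ucm a) 1.

Definition pderiv (a : J) (P : oscillator) : oscillator :=
  \sum_(m <- msupp P)
    mkmalgU (divcm m (ucm a)) (mcoeff m P *+ m a).

Variables (g : lieSuper) (e : generators g) (B : g -> g -> C) (x del : J -> g).

(* homogeneity is with respect to the principal grading *)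
Definition dual_bases : Prop :=
  [/\ is_basis (gminus e) x, is_basis (gplus e) del,
      forall a, exists k l, principal e k (x a) /\ principal e l (del a)
    & forall a b, B (del a) (x b) = if a == b then 2^-1 else 0].

(* The Clifford action of z in g_1 is multiplication by cl_minus z plus the
   derivation cl_plus z: the coordinates of z on x_b and del_b are
   2 B(del_b, z) and 2 B(z, x_b). The sums over J have finite support. *)
Definition cl_minus (z : g) : oscillator :=
  \sum_(b \in [set: J]) (2 * B (del b) z) *: xvar b.

Definition cl_plus (z : g) (P : oscillator) : oscillator :=
  \sum_(b \in [set: J]) (2 * B z (x b)) *: pderiv b P.

(* :z del_a: and :z x_a: for z in g_1 *)
Definition normal_del (z : g) (a : J) (P : oscillator) : oscillator :=
  cl_minus z * pderiv a P + cl_plus z (pderiv a P).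

Definition normal_x (z : g) (a : J) (P : oscillator) : oscillator :=
  cl_minus z * (xvar a * P) + xvar a * cl_plus z P.

Definition oscillator_act (rho1 : g -> C) (z : g) (P : oscillator) : oscillator :=
  2^-1 *: (\sum_(a \in [set: J]) normal_del (br z (x a)) a P)
  - 2^-1 *: (\sum_(a \in [set: J]) normal_x (br z (del a)) a P)
  - rho1 z *: P.

(* the derivation of S(g_{-1}) extending the adjoint action of z in g_0 on
   g_{-1} *)
Definition symmetric_act (z : g) (P : oscillator) : oscillator :=
  \sum_(a \in [set: J]) cl_minus (br z (x a)) * pderiv a P.

Variables (M : superModule g) (T : tensorProduct M oscillator).

(* Linear operators on M \otimes C[x_a] are specified by their values on pure
   tensors, which determine them. *)

Definition oscillator_tensor_action (rho1 : g -> C) (pi : g -> {linear T -> T}) :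
    Prop :=
  forall z v P, gbar0 z ->
    pi z (tens T v P) = tens T (act z v) P + tens T v (oscillator_act rho1 z P).

Definition cochain_action (tau : g -> {linear T -> T}) : Prop :=
  forall z v P, gbar0 z ->
    tau z (tens T v P) = tens T (act z v) P + tens T v (symmetric_act z P).

Definition dirac_operator (D : {linear T -> T}) : Prop :=
  forall v P, D (tens T v P) =
    2 *: \sum_(a \in [set: J]) (tens T (act (x a) (psign v)) (pderiv a P)
                                - tens T (act (del a) (psign v)) (xvar a * P)).

(* \bigoplus_i M \otimes S^i(g_{-1}) is M \otimes C[x_a] *)
Definition coboundary (d : {linear T -> T}) : Prop :=
  forall v P, d (tens T v P) =
    \sum_(a \in [set: J]) tens T (act (del a) (psign v)) (xvar a * P).

(* ker D and H^* \otimes C_{-rho1} are isomorphic g_0-modules, where g_0 acts on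
   ker D through pi and on H^* through tau, and the twist adds the scalar
   - rho1 y: y [z] = [tau y z - rho1 y z]. *)
Definition kernel_iso_cohomology (rho1 : g -> C) (pi tau : g -> {linear T -> T})
    (D d : {linear T -> T}) : Prop :=
  exists f : {linear kernel D -> cohomology d},
    bijective f /\
    forall (y : g) (t : kernel D) (z : kernel d), gbar0 y -> f t = coclass z ->
      exists (t' : kernel D) (z' : kernel d),
        [/\ ker_val t' = pi y (ker_val t),
            ker_val z' = tau y (ker_val z) - rho1 y *: ker_val z
          & f t' = coclass z'].

End Oscillator.
End KacMoody.
End Super.

(* Main.v *)
(** Write D = 2 (delta - d) with delta = sum_a x_a (x) d/dx_a. Unitarity and the Fock
    inner product on C[x_a] give a positive definite Hermitian form on
    M (x) C[x_a] for which delta is the adjoint of - d, so D is self-adjoint,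
    ker D is contained in ker d /\ ker delta, and ker D meets im d trivially. Every
    vector lies in a finite-dimensional D-stable subspace: the principal grading puts
    M in degrees bounded above with finite-dimensional pieces, x_a and del_a have
    opposite nonzero degrees, and D preserves the total degree. Hence
    M (x) C[x_a] = ker D + im D, and z |-> [z] is a bijection from ker D onto the
    cohomology of d. As B vanishes on g_{+1} x g_{+1} and on g_{-1} x g_{-1}, reordering
    the normally ordered products shows that the oscillator action is the derivation
    action on S(g_{-1}) shifted by - rho1, and both commute with d and D. *)

From HB Require Import structures.
Require Import Defs.
From mathcomp Require Import all_boot all_order all_algebra.
From mathcomp Require Import finmap.
From mathcomp Require Import boolp classical_sets functions cardinality fsbigop reals.
From mathcomp Require Import complex.
From mathcomp Require Import monalg.

Set Implicit Arguments.
Unset Strict Implicit.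
Unset Printing Implicit Defensive.

Import Order.TTheory GRing.Theory Num.Theory.

Local Open Scope classical_set_scope.
Local Open Scope ring_scope.

(** * Linear algebra *)

Lemma linear_apply (K : fieldType) (V W : lmodType K) (f : {linear V -> W}) :
  linear f.
Proof. by move=> a u v; rewrite linearP. Qed.

Section Subspaces.
Variables (K : fieldType) (V : lmodType K).
Implicit Types S : set V.

Lemma subspaceD S u v : subspace S -> S u -> S v -> S (u + v).
Proof. by case=> _ h su sv; have := h 1 u v su sv; rewrite scale1r. Qed.

Lemma subspaceZ S a u : subspace S -> S u -> S (a *: u).
Proof. by case=> s0 h su; have := h a u 0 su s0; rewrite addr0. Qed.

Lemma subspaceN S u : subspace S -> S u -> S (- u).
Proof. by move=> sS su; rewrite -scaleN1r; apply: subspaceZ. Qed.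

Lemma subspaceB S u v : subspace S -> S u -> S v -> S (u - v).
Proof. by move=> sS su sv; apply: subspaceD => //; apply: subspaceN. Qed.

Lemma subspace_sum S (I : Type) (r : seq I) (F : I -> V) :
  subspace S -> (forall i, S (F i)) -> S (\sum_(i <- r) F i).
Proof.
move=> sS SF; elim: r => [|i r IH]; first by rewrite big_nil; case: sS.
by rewrite big_cons; apply: subspaceD.
Qed.

Lemma subspace_preim (W : lmodType K) (f : V -> W) (S : set W) :
  linear f -> subspace S -> subspace (f @^-1` S).
Proof.
move=> lf [s0 sS]; split=> /=.
  have := lf 1 0 0; rewrite !scale1r addr0 => f0.
  by have -> : f 0 = 0 by apply: (addrI (f 0)); rewrite addr0 -f0.
by move=> a u v su sv; rewrite lf; apply: sS.
Qed.

Lemma subspace_bigcap (I : Type) (F : I -> set V) :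
  (forall i, subspace (F i)) -> subspace [set v | forall i, F i v].
Proof.
move=> sF; split=> [i|a u v Fu Fv i]; first by case: (sF i).
by case: (sF i) => _; apply.
Qed.

Fixpoint lspan (w : seq V) : set V :=
  if w is x :: w' then [set v | exists a, lspan w' (v - a *: x)] else [set 0].

Lemma lspan_subspace w : subspace (lspan w).
Proof.
elim: w => [|x w IH] /=.
  by split=> // a u v /= -> ->; rewrite scaler0 addr0.
split; first by exists 0; rewrite scale0r subr0; case: IH.
move=> a u v [b hu] [c hv]; exists (a * b + c).
have -> : a *: u + v - (a * b + c) *: x = a *: (u - b *: x) + (v - c *: x).
  by rewrite scalerBr scalerDl scalerA opprD addrACA.
by case: IH => _; apply.
Qed.

Lemma lspan_mem (w : seq V) x : x \in w -> lspan w x.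
Proof.
elim: w => //= z w IH; rewrite in_cons => /orP[/eqP->|/IH xw].
  by exists 1; rewrite scale1r subrr; case: (lspan_subspace w).
by exists 0; rewrite scale0r subr0.
Qed.

Lemma lspan_sub (w : seq V) S : subspace S -> (forall x, x \in w -> S x) ->
  lspan w `<=` S.
Proof.
move=> sS; elim: w => [|z w IH] Sw v /=; first by move=> ->; case: sS.
case=> a /IH hv; rewrite -[v](subrK (a *: z)); apply: subspaceD => //.
  by apply: hv => x xw; apply: Sw; rewrite in_cons xw orbT.
by apply: subspaceZ => //; apply: Sw; rewrite in_cons eqxx.
Qed.

Lemma lspan_cat w1 w2 u v : lspan w1 u -> lspan w2 v -> lspan (w1 ++ w2) (u + v).
Proof.
elim: w1 u => [|x w1 IH] u /=; first by move=> ->; rewrite add0r.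
by move=> [a hu] hv; exists a; rewrite addrAC; apply: IH.
Qed.

Lemma lspan_coord w v : lspan w v ->
  exists c : 'I_(size w) -> K, v = \sum_i c i *: w`_i.
Proof.
elim: w v => [|x w IH] v /=; first by move=> ->; exists (fun=> 0); rewrite big_ord0.
case=> a /IH [c vE]; exists (fun i => oapp c a (unlift ord0 i)).
rewrite big_ord_recl unlift_none /= -[LHS](subrK (a *: x)) vE addrC.
by congr (_ + _); apply: eq_bigr => i _; rewrite liftK.
Qed.

Lemma lspan_dependent (w : seq V) (n : nat) (u : 'I_n -> V) :
  (size w < n)%N -> (forall i, lspan w (u i)) ->
  exists c : 'I_n -> K, (exists i, c i != 0) /\ \sum_i c i *: u i = 0.
Proof.
move=> lt_n hu; have [A uE] := choice (fun i => lspan_coord (hu i)).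
pose N := \matrix_(i, j) A i j.
have : kermx N != 0.
  rewrite -mxrank_eq0 mxrank_ker subn_eq0 -ltnNge.
  exact: leq_ltn_trans (rank_leq_col N) lt_n.
case/rowV0Pn => r /sub_kermxP rN r0.
exists (fun i => r 0 i); split.
  exact/rV0Pn.
under eq_bigr do rewrite uE scaler_sumr.
rewrite exchange_big big1 // => j _.
under eq_bigr do rewrite scalerA.
rewrite -scaler_suml; have /rowP/(_ j) := rN.
rewrite !mxE => r0j; rewrite (_ : \sum_(i < n) _ = 0) ?scale0r // -[RHS]r0j.
by apply: eq_bigr => i _; rewrite mxE.
Qed.

Definition fin_dim S : Prop := exists w, S `<=` lspan w.

Lemma fin_dimS S S' : S `<=` S' -> fin_dim S' -> fin_dim S.
Proof. by move=> SS' [w wS']; exists w => v /SS'/wS'. Qed.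

End Subspaces.

Lemma lspan_map (K : fieldType) (V W : lmodType K) (f : {linear V -> W}) w v :
  lspan w v -> lspan [seq f x | x <- w] (f v).
Proof.
elim: w v => [|x w IH] v /=; first by move=> ->; rewrite linear0.
by case=> a /IH; rewrite linearB linearZ; exists a.
Qed.

Lemma fin_dim_sum (K : fieldType) (V W : lmodType K) (I : Type) (r : seq I)
    (f : I -> {linear V -> W}) (S : I -> set V) :
  (forall i, fin_dim (S i)) ->
  fin_dim [set v | exists u, (forall i, S i (u i)) /\ v = \sum_(i <- r) f i (u i)].
Proof.
move=> fS; have [w wS] := choice fS; elim: r => [|i r [wr IH]].
  by exists [::] => v [u [_ ->]]; rewrite big_nil.
exists ([seq f i x | x <- w i] ++ wr) => v [u [Su ->]]; rewrite big_cons.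
by apply: lspan_cat; [apply/lspan_map/wS|apply: IH; exists u].
Qed.

Section EigenSum.
Variables (K : fieldType) (V : lmodType K) (f : {linear V -> V}).
Variables (I : eqType) (lam : I -> K).
Hypothesis lam_inj : injective lam.

Lemma eigen_sum_eq0 (s : seq I) (u : I -> V) :
  uniq s -> (forall i, f (u i) = lam i *: u i) -> \sum_(i <- s) u i = 0 ->
  forall i, i \in s -> u i = 0.
Proof.
elim: s u => [//|j s IH] u /= /andP[js us] fu s0.
have s1 : forall i, i \in s -> u i = 0.
  move=> i si; have := IH (fun i => (lam i - lam j) *: u i) us.
  have /[swap]/[apply] : forall i, f ((lam i - lam j) *: u i) =
      lam i *: ((lam i - lam j) *: u i).
    by move=> k; rewrite linearZ /= fu !scalerA mulrC.
  have -> : \sum_(i <- s) (lam i - lam j) *: u i = 0.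
    have : f (\sum_(i <- j :: s) u i) = 0 by rewrite s0 linear0.
    rewrite linear_sum big_cons /= => h.
    have : f (u j) + \sum_(i <- s) f (u i) - lam j *: (u j + \sum_(i <- s) u i) = 0.
      by rewrite h sub0r; move: s0; rewrite big_cons => ->; rewrite scaler0 oppr0.
    rewrite fu scalerDr opprD addrACA subrr add0r scaler_sumr -sumrB => h'.
    by apply: etrans h'; apply: eq_bigr => k _; rewrite fu scalerBl.
  move=> /(_ erefl _ si) /eqP; rewrite scaler_eq0 subr_eq0 => /orP[/eqP/lam_inj ij|/eqP//].
  by rewrite ij in si; rewrite si in js.
move=> i; rewrite inE => /orP[/eqP->|/s1//].
by move: s0; rewrite big_cons big_seq big1 ?addr0.
Qed.

End EigenSum.

(* The span of the pure tensors is a submodule which itself receives the bilinear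
   map, so that the universal property makes the identity factor through it. *)
Section TensorSpan.
Variables (K : fieldType) (V W : lmodType K) (T : tensorProduct V W) (S : set T).
Hypotheses (S_sub : subspace S) (S_tens : forall v w, S (tens T v w)).

Definition span_pred : {pred T} := fun t => `[< S t >].

Fact span_pred_submod : submod_closed span_pred.
Proof.
case: S_sub => s0 h; split; first by apply/asboolP.
by move=> a u v /asboolP su /asboolP sv; apply/asboolP/h.
Qed.
HB.instance Definition _ :=
  GRing.isSubmodClosed.Build K (tensor_sort T) span_pred span_pred_submod.

Record span_sub : Type := SpanSub { span_val : T; span_valP : span_val \in span_pred }.
HB.instance Definition _ := [isSub for span_val].
HB.instance Definition _ := [Choice of span_sub by <:].
HB.instance Definition _ := [SubChoice_isSubLmodule of span_sub by <:].

Lemma tensor_ind t : S t.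
Proof.
have P v w : tens T v w \in span_pred by apply/asboolP/S_tens.
pose f v w : span_sub := SpanSub (P v w).
have f_bilin : bilin f.
  case: (tens_bilin T) => l r; split=> [w a u v|v a u w]; apply: val_inj => /=.
    exact: l.
  exact: r.
have [phi phiE] := tens_lift T f_bilin.
pose psi : {linear T -> T} := \val \o phi.
have : psi t = idfun t by apply: tens_uniq => v w; rewrite /psi /= phiE.
rewrite /= => <-; exact/asboolP/(valP (phi t)).
Qed.

End TensorSpan.

Lemma uniform_support (I : eqType) (J : choiceType) (r : seq I) (F : I -> J -> Prop) :
  (forall i, exists A : {fset J}, forall a, a \notin A -> F i a) ->
  exists A : {fset J}, forall i a, i \in r -> a \notin A -> F i a.
Proof.
move=> h; elim: r => [|i r [A hA]]; first by exists fset0.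
have [B hB] := h i; exists (A `|` B)%fset => j a.
by rewrite in_cons in_fsetU negb_or => /orP[/eqP->|jr] /andP[aA aB]; [apply: hB|apply: hA].
Qed.

Lemma basis_expand (K : fieldType) (V : lmodType K) (J : choiceType) (S : set V)
    (e : J -> V) (phi : J -> V -> K) :
  is_basis S e -> (forall b, linear (phi b : V -> K^o)) ->
  (forall a b, phi b (e a) = (a == b)%:R) ->
  forall v, S v -> exists2 A : {fset J}, forall b, b \notin A -> phi b v = 0
    & v = \sum_(b <- A) phi b v *: e b.
Proof.
move=> [_ _ gen] lphi phie v /gen [s [c vE]].
pose phil b : {linear V -> K^o} :=
  HB.pack (phi b : V -> K^o) (GRing.isLinear.Build K V K^o *:%R _ (lphi b)).
have phiv b : phi b v = \sum_(a <- s) c a * (a == b)%:R.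
  rewrite -[LHS]/(phil b v) vE linear_sum; apply: eq_bigr => a _.
  by rewrite linearZ_LR /= phie.
exists [fset a in s]%fset => [b|].
  rewrite in_fset /= => bs; rewrite phiv big_seq big1 // => a sa.
  by case: eqP => [ab|_]; [rewrite -ab sa in bs|rewrite mulr0].
under eq_bigr => b _ do rewrite phiv scaler_suml.
rewrite exchange_big /= {1}vE; apply: eq_big_seq => a sa.
have as_ : a \in [fset a in s]%fset by rewrite in_fset.
rewrite (big_fsetD1 a as_) big1_fset /= => [|b].
  by rewrite eqxx mulr1 addr0.
by rewrite in_fsetD1 eq_sym => /andP[/negPf ->]; rewrite mulr0 scale0r.
Qed.

(** * Hodge decomposition *)

Section KernelSplit.
Variables (K : fieldType) (V : lmodType K) (D : {linear V -> V}).

Definition dirac_split : set V :=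
  [set v | exists t w, D t = 0 /\ v = t + D w].

Lemma dirac_split_subspace : subspace dirac_split.
Proof.
split; first by exists 0, 0; rewrite !linear0 addr0.
move=> a _ _ [t [w [Dt ->]]] [t' [w' [Dt' ->]]].
exists (a *: t + t'), (a *: w + w'); rewrite !linearP Dt Dt' scaler0 addr0.
by split=> //; rewrite scalerDr addrACA.
Qed.

Hypothesis ker_sqr : forall v, D (D v) = 0 -> D v = 0.

Lemma dirac_split_poly n (c : nat -> K) v :
  D (\sum_(k < n) c k *: iter k D v) = 0 -> (exists2 k, (k < n)%N & c k != 0) ->
  dirac_split v.
Proof.
elim: n c => [c _ [] //|n IH c]; rewrite big_ord_recl /=.
set u := (X in _ + X).
have uE : u = D (\sum_(k < n) c k.+1 *: iter k D v).
  by rewrite linear_sum; apply: eq_bigr => k _; rewrite linearZ.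
have [c0|c0] := eqVneq (c 0) 0.
  rewrite c0 scale0r add0r => Du [[|k] kn ck]; first by rewrite c0 eqxx in ck.
  apply: (IH (fun k => c k.+1)); last by exists k.
  by apply: ker_sqr; rewrite -uE.
move=> Du _; exists ((c 0)^-1 *: (c 0 *: v + u)).
exists (- (c 0)^-1 *: (\sum_(k < n) c k.+1 *: iter k D v)).
rewrite [D (_ *: _)]linearZ /= Du scaler0; split=> //.
by rewrite linearZ /= -uE scaleNr -scalerBr addrK scalerA mulVf // scale1r.
Qed.

Lemma dirac_split_fin_dim (W : set V) v :
  fin_dim W -> (forall u, W u -> W (D u)) -> W v -> dirac_split v.
Proof.
move=> [w wW] WD Wv.
have Wi k : W (iter k D v) by elim: k => //= k; apply: WD.
have [c [[i ci] c0]] := lspan_dependent (n := (size w).+1) (u := fun i => iter i D v)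
  (ltnSn _) (fun i => wW _ (Wi i)).
apply: (@dirac_split_poly (size w).+1 (fun k => c (inord k))).
  rewrite (_ : \sum_(k < _) _ = 0) ?linear0 // -[RHS]c0.
  by apply: eq_bigr => k _; rewrite inord_val.
by exists i; rewrite ?inord_val.
Qed.

End KernelSplit.

Section Hodge.
Variables (R : realType) (V : lmodType R[i]).
Local Notation C := R[i].
Variables (D d del : {linear V -> V}) (S : V -> V -> C).
Hypotheses (S_linear : forall w, linear (S^~ w : V -> C^o))
           (S_herm : forall v w, S v w = (S w v)^*)
           (S_pos : forall v, v != 0 -> 0 < S v v)
           (del_adj : forall v w, S (del v) w = - S v (d w))
           (DE : forall v, D v = 2 *: (del v - d v))
           (dd : forall v, d (d v) = 0).

Let Sl w : {linear V -> C^o} :=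
  HB.pack (S^~ w) (GRing.isLinear.Build C V C^o *:%R (S^~ w) (S_linear w)).

Lemma formDl u v w : S (u + v) w = S u w + S v w.
Proof. exact: (linearD (Sl w)). Qed.

Lemma formZl a v w : S (a *: v) w = a * S v w.
Proof. by have := linearZ_LR (Sl w) a v. Qed.

Lemma form0l w : S 0 w = 0.
Proof. exact: (linear0 (Sl w)). Qed.

Lemma formNl v w : S (- v) w = - S v w.
Proof. exact: (linearN (Sl w)). Qed.

Lemma formDr u v w : S u (v + w) = S u v + S u w.
Proof. by rewrite S_herm formDl rmorphD /= -!S_herm. Qed.

Lemma formNr u v : S u (- v) = - S u v.
Proof. by rewrite S_herm formNl rmorphN /= -S_herm. Qed.

Lemma formZr a u v : S u (a *: v) = a^* * S u v.
Proof. by rewrite S_herm formZl rmorphM /= -S_herm. Qed.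

Lemma form0r u : S u 0 = 0.
Proof. by rewrite S_herm form0l rmorph0. Qed.

Lemma form_suml (I : Type) (r : seq I) (F : I -> V) w :
  S (\sum_(i <- r) F i) w = \sum_(i <- r) S (F i) w.
Proof. exact: (linear_sum (Sl w)). Qed.

Lemma form_sumr (I : Type) (r : seq I) (F : I -> V) w :
  S w (\sum_(i <- r) F i) = \sum_(i <- r) S w (F i).
Proof.
rewrite S_herm form_suml rmorph_sum; apply: eq_bigr => i _.
by rewrite [RHS]S_herm.
Qed.

Lemma form_eq0 v : S v v = 0 -> v = 0.
Proof. by move=> Sv; apply/eqP/contraT => /S_pos; rewrite Sv ltxx. Qed.

Lemma d_adj v w : S (d v) w = - S v (del w).
Proof. by rewrite S_herm -[S w _]opprK -del_adj rmorphN /= -S_herm. Qed.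

Lemma dirac_self_adjoint v w : S (D v) w = S v (D w).
Proof.
rewrite !DE formZl formZr conjC_nat; congr (_ * _).
by rewrite formDl formDr formNl formNr del_adj d_adj opprK addrC.
Qed.

Lemma dirac_ker_sqr v : D (D v) = 0 -> D v = 0.
Proof. by move=> DDv; apply: form_eq0; rewrite dirac_self_adjoint DDv form0r. Qed.

Lemma dirac_harmonic v : D v = 0 -> d v = 0 /\ del v = 0.
Proof.
rewrite DE => /eqP; rewrite scaler_eq0 pnatr_eq0 /= subr_eq0 => /eqP delv.
have dv : d v = 0 by apply: form_eq0; rewrite -{1}delv del_adj dd form0r oppr0.
by rewrite delv.
Qed.

Lemma harmonic_exact v w : D v = 0 -> v = d w -> v = 0.
Proof.
move=> /dirac_harmonic [_ delv] vE; apply: form_eq0.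
by rewrite {2}vE -[LHS]opprK -del_adj delv form0l oppr0.
Qed.

Hypothesis split_all : forall v, dirac_split D v.

Lemma closed_harmonic z : d z = 0 -> exists t s, D t = 0 /\ t - z = d s.
Proof.
have [t [w [Dt ->]]] := split_all z; have [dt _] := dirac_harmonic Dt.
rewrite linearD dt add0r DE linearZ linearB /= dd subr0 => /eqP.
rewrite scaler_eq0 pnatr_eq0 /= => /eqP ddw.
have -> : del w = 0 by apply: form_eq0; rewrite del_adj ddw form0r oppr0.
exists t, (2 *: w); split=> //.
by rewrite sub0r scalerN opprB addrCA subrr addr0 linearZ.
Qed.

Definition dirac_closed (t : kernel D) : kernel d :=
  Kernel (introT eqP (dirac_harmonic (eqP (ker_valP t))).1 : ker_val t \in ker_pred d).

Definition dirac_class (t : kernel D) : cohomology d := coclass (dirac_closed t).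

Fact dirac_class_linear : linear dirac_class.
Proof.
move=> a u v; rewrite -[a *: dirac_class u]/(coscale a _) coscaleE -coclassD.
by congr coclass; apply: val_inj.
Qed.
HB.instance Definition _ :=
  GRing.isLinear.Build C (kernel D) (cohomology d) _ dirac_class dirac_class_linear.

Lemma dirac_class_eq t z :
  dirac_class t = coclass z <-> exists s, d s = ker_val t - ker_val z.
Proof. exact: coclass_eq. Qed.

Lemma dirac_class_bij : bijective dirac_class.
Proof.
have inj : injective dirac_class.
  move=> t t' /coclass_eq [s /= ds].
  apply/val_inj/eqP; rewrite -subr_eq0; apply/eqP.
  apply: (@harmonic_exact _ s _ (esym ds)).
  by rewrite linearB /= !(eqP (ker_valP _)) subrr.
have surj c : {t | dirac_class t = c}.
  apply: cid; have [z ->] := coclassP c.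
  have [t [s [Dt ts]]] := closed_harmonic (eqP (ker_valP z)).
  exists (Kernel (introT eqP Dt : t \in ker_pred D)).
  by apply/dirac_class_eq; exists s.
exists (fun c => sval (surj c)) => [t|c]; last by case: (surj c).
by apply: inj; case: (surj _).
Qed.

End Hodge.

(** * Polynomials *)

(* Locked, to keep unification from comparing coefficients in C by computation. *)
HB.lock Definition mono (R : realType) (J : choiceType) (m : {cmonom J}) :
  oscillator R J := mkmalgU m 1.

Section Polynomials.
Variables (R : realType) (J : choiceType).
Local Notation C := R[i].
Local Notation O := (oscillator R J).
Local Notation mon := {cmonom J}.
Local Notation mono := (mono R).
Implicit Types (P Q : O) (m : mon) (a b : J).

Definition coef m (P : O) : C^o := mcoeff m P.

Fact coef_linear m : linear (coef m).
Proof. by move=> c P Q; rewrite /coef mcoeffD mcoeffZ. Qed.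
HB.instance Definition _ m := GRing.isLinear.Build C O C^o *:%R (coef m) (coef_linear m).

Lemma coefZ m c P : coef m (c *: P) = c * coef m P.
Proof. exact: mcoeffZ. Qed.

Lemma coefL m c P Q : coef m (c *: P + Q) = c * coef m P + coef m Q.
Proof. exact: coef_linear. Qed.

Lemma coefP P Q : (forall m, coef m P = coef m Q) -> P = Q.
Proof. by move=> h; apply/malgP. Qed.

Lemma coef_mono m m' : coef m' (mono m) = (m == m')%:R.
Proof. by rewrite mono.unlock; apply: mcoeffU1. Qed.

Lemma coef_supp P m : m \notin msupp P -> coef m P = 0.
Proof. exact: mcoeff_outdom. Qed.

Lemma poly_mono P : P = \sum_(m <- msupp P) coef m P *: mono m.
Proof.
rewrite {1}(monalgE P); apply: eq_bigr => m _; apply: coefP => k.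
by rewrite coefZ coef_mono mulr_natr; apply: mcoeffU.
Qed.

Lemma coef_pderiv a m P : coef m (pderiv a P) = coef (mulcm m (ucm a)) P *+ (m a).+1.
Proof.
rewrite /pderiv linear_sum /=.
pose k0 := mulcm m (ucm a).
have k0a : k0 a = (m a).+1 by rewrite mulcmE ucmE eqxx addn1.
have term k : k != k0 ->
    coef m (mkmalgU (divcm k (ucm a)) (mcoeff k P *+ k a)) = 0.
  move=> kk0; rewrite /coef mcoeffU; case: eqP => [e|]; last by rewrite mulr0n.
  have [->|ka] := eqVneq (k a) 0%N; first by rewrite mulr0n mul0rn.
  case/eqP: kk0; apply/eqP/cmP => j; rewrite mulcmE -e divcmE ucmE subnK //.
  by case: eqP => // <-; rewrite lt0n.
have [k0P|k0P] := boolP (k0 \in msupp P).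
  rewrite (big_fsetD1 k0) //= big1_fset ?addr0 => [|k].
    rewrite /coef mcoeffU -k0a (_ : divcm _ _ == m) ?mulr1n //.
    by apply/cmP => j; rewrite divcmE mulcmE addnK.
  by rewrite !inE => /andP[kk0 _] _; apply: term.
rewrite (coef_supp k0P) mul0rn big1_fset // => k kP _.
by apply: term; apply: contraNneq k0P => <-.
Qed.

Fact pderiv_linear a : linear (@pderiv R J a).
Proof.
move=> c P Q; apply: coefP => m.
apply: etrans (coef_pderiv a m _) _; apply: etrans (esym (coefL m c _ _)).
apply: etrans (congr1 (fun z => z *+ _) (coefL _ c P Q)) _.
by rewrite mulrnDl -mulrnAr -!coef_pderiv.
Qed.
HB.instance Definition _ a := GRing.isLinear.Build C O O *:%R (@pderiv R J a) (pderiv_linear a).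

Lemma pderiv_mono a m : pderiv a (mono m) = (m a)%:R *: mono (divcm m (ucm a)).
Proof.
apply: coefP => k; apply: etrans (coef_pderiv a k _) _.
apply: etrans (esym (coefZ k _ _)); rewrite !coef_mono.
have [ma|ma] := eqVneq (m a) 0%N.
  rewrite ma mul0r; case: eqP => [e|]; last by rewrite mul0rn.
  by move: ma; rewrite e mulcmE ucmE eqxx addn1.
have -> : (m == mulcm k (ucm a)) = (divcm m (ucm a) == k).
  apply/eqP/eqP => [->|<-]; apply/eqP/cmP => j; rewrite ?mulcmE !divcmE ?mulcmE ?addnK //.
  by rewrite subnK // ucmE; case: eqP => // <-; rewrite lt0n.
case: eqP => [<-|]; last by rewrite mulr0 mul0rn.
by rewrite divcmE ucmE eqxx subn1 prednK ?lt0n // mulr1.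
Qed.

Lemma xvar_mono a m : xvar R a * mono m = mono (mulcm (ucm a) m).
Proof. by rewrite /xvar mono.unlock malgM_def fgmulUU mulr1. Qed.

End Polynomials.

(* Abstracts from {malg C[_]}, whose operations unification would otherwise unfold. *)
Record polynomials (C : fieldType) (J : choiceType) := Polynomials {
  pol :> comAlgType C;
  mon : {cmonom J} -> pol;
  cf : {cmonom J} -> {linear pol -> C^o};
  xv : J -> pol;
  pd : J -> {linear pol -> pol};
  cf_mon : forall m k, cf k (mon m) = (m == k)%:R;
  mon_expand : forall P, exists2 A : {fset {cmonom J}},
    forall m, m \notin A -> cf m P = 0 & P = \sum_(m <- A) cf m P *: mon m;
  xv_mon : forall a m, xv a * mon m = mon (mulcm (ucm a) m);
  pd_mon : forall a m, pd a (mon m) = (m a)%:R *: mon (divcm m (ucm a))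
}.

Lemma mono_expand (R : realType) (J : choiceType) (P : oscillator R J) :
  exists2 A : {fset {cmonom J}}, forall m, m \notin A -> coef m P = 0
    & P = \sum_(m <- A) coef m P *: mono R m.
Proof. by exists (msupp P) => [m /coef_supp|]; last exact: poly_mono. Qed.

Definition oscillator_polynomials (R : realType) (J : choiceType) :
  polynomials R[i] J :=
  @Polynomials R[i] J (oscillator R J) (@mono R J) (@coef R J) (@xvar R J) (@pderiv R J)
    (fun m k => coef_mono R m k) (@mono_expand R J) (@xvar_mono R J)
    (@pderiv_mono R J).

Section PolynomialTheory.
Variables (C : fieldType) (J : choiceType) (O : polynomials C J).
Implicit Types (P Q : O) (m : {cmonom J}) (a b : J).

Lemma pol_ind (S : set O) : subspace S -> (forall m, S (mon O m)) -> forall P, S P.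
Proof.
move=> sS Sm P; have [A _ ->] := mon_expand P; apply: subspace_sum => // m.
exact: subspaceZ.
Qed.

Lemma pdC a b P : pd O a (pd O b P) = pd O b (pd O a P).
Proof.
have [A _ ->] := mon_expand P; rewrite !linear_sum; apply: eq_bigr => m _ /=.
rewrite !linearZ /= !pd_mon !linearZ /= !pd_mon !scalerA.
have [->//|ab] := eqVneq a b.
have -> : divcm (divcm m (ucm b)) (ucm a) = divcm (divcm m (ucm a)) (ucm b).
  by apply/eqP/cmP => j; rewrite !divcmE subnAC.
congr (_ *: _); rewrite -!mulrA !(mulrCA _%:R) -!natrM !divcmE !ucmE (negPf ab) eq_sym (negPf ab).
by rewrite !subn0 mulnC.
Qed.

Lemma pd_xv a b P : pd O a (xv O b * P) = (a == b)%:R *: P + xv O b * pd O a P.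
Proof.
have [A _ ->] := mon_expand P.
rewrite mulr_sumr !linear_sum /= mulr_sumr -big_split; apply: eq_bigr => m _ /=.
rewrite -scalerAr !linearZ /= -scalerAr -scalerDr; congr (_ *: _).
rewrite xv_mon !pd_mon mulcmE ucmE -scalerAr xv_mon natrD scalerDl eq_sym.
have [->|ab] := eqVneq a b.
  rewrite !scale1r; congr (_ + _).
    by congr mon; apply/eqP/cmP => j; rewrite divcmE mulcmE addKn.
  have [->|mb] := eqVneq (m b) 0%N; first by rewrite !scale0r.
  congr (_ *: mon _ _); apply/eqP/cmP => j; rewrite mulcmE !divcmE mulcmE addKn ucmE.
  case: eqP => [<-|]; rewrite ?add0n ?subn0 //=; rewrite add1n subn1 prednK ?lt0n //.
rewrite !scale0r !add0r; congr (_ *: mon _ _); apply/eqP/cmP => j.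
rewrite !mulcmE !divcmE mulcmE !ucmE.
have [<-|aj] := eqVneq a j; first by rewrite eq_sym (negPf ab) !add0n.
by rewrite !subn0.
Qed.

Lemma cf_pd a m P : cf O m (pd O a P) = (m a).+1%:R * cf O (mulcm (ucm a) m) P.
Proof.
have [A _ ->] := mon_expand P; rewrite !linear_sum /= mulr_sumr.
apply: eq_bigr => k _; rewrite !linearZ /= pd_mon linearZ /= !cf_mon mulrCA.
congr (_ * _); rewrite /GRing.scale /=.
have [ka|ka] := eqVneq (k a) 0%N.
  rewrite ka mul0r; case: eqP => [e|]; last by rewrite mulr0.
  by move: ka; rewrite e mulcmE ucmE eqxx.
have -> : (k == mulcm (ucm a) m) = (divcm k (ucm a) == m).
  apply/eqP/eqP => [->|<-]; apply/eqP/cmP => j; rewrite ?mulcmE !divcmE ?mulcmE ?addKn //.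
  by rewrite subnKC // ucmE; case: eqP => // <-; rewrite lt0n.
case: eqP => [<-|]; last by rewrite !mulr0.
by rewrite divcmE ucmE eqxx subn1 prednK ?lt0n.
Qed.

Lemma pd_supp P : exists A : {fset J}, forall a, a \notin A -> pd O a P = 0.
Proof.
pose S := [set P : O | exists A : {fset J}, forall a, a \notin A -> pd O a P = 0].
apply: (pol_ind (S := S)) => [|m]; rewrite /S /=.
  split; first by exists fset0 => a _; rewrite linear0.
  move=> c u v [A hA] [B hB]; exists (A `|` B)%fset => a.
  by rewrite inE negb_or => /andP[/hA ua /hB va]; rewrite linearP ua va scaler0 addr0.
exists (finsupp m) => a am; rewrite pd_mon.
by move: am; rewrite -cmE_eq0 => /eqP ->; rewrite scale0r.
Qed.

End PolynomialTheory.

Section MonomialFactorial.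
Variable J : choiceType.
Implicit Types (m : {cmonom J}) (a : J).

Definition mfact m : nat := (\prod_(a <- finsupp m) (m a)`!)%N.

Lemma mfact_gt0 m : (0 < mfact m)%N.
Proof.
rewrite /mfact; elim/big_ind: _ => // [x y|a _]; last by rewrite fact_gt0.
by rewrite muln_gt0 => -> ->.
Qed.

Lemma mfactE (A : {fset J}) m : (finsupp m `<=` A)%fset ->
  mfact m = (\prod_(a <- A) (m a)`!)%N.
Proof.
move=> mA; rewrite /mfact; apply/big_fset_incl => // a _.
by rewrite -cmE_eq0 => /eqP ->.
Qed.

Lemma mfactM a m : mfact (mulcm (ucm a) m) = ((m a).+1 * mfact m)%N.
Proof.
pose A := (a |` finsupp m)%fset.
have aA : a \in A by rewrite !inE eqxx.
have mA : (finsupp m `<=` A)%fset by rewrite fsubsetU1.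
have maA : (finsupp (mulcm (ucm a) m) `<=` A)%fset.
  by rewrite (mdomD (ucm a) m) mdomU.
rewrite (mfactE mA) (mfactE maA) !(big_fsetD1 a aA) /= mulnA.
rewrite mulcmE ucmE eqxx add1n factS; congr (_ * _)%N.
apply: eq_big_seq => b; rewrite !inE => /andP[ba _].
by rewrite mulcmE ucmE eq_sym (negPf ba).
Qed.

End MonomialFactorial.

(** * Operators on the tensor product *)

Section TensorCoefficients.
Variables (R : realType) (J : choiceType) (M : lmodType R[i]).
Local Notation C := R[i].
Local Notation monom := {cmonom J}.
Variables (O : polynomials C J) (T : tensorProduct M O).
Implicit Types (m : monom) (t u : T) (v w : M) (P Q : O).

Definition tensl P : M -> T := tens T ^~ P.
Definition tensr v : O -> T := tens T v.

Fact tensl_linear P : linear (tensl P).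
Proof. by case: (tens_bilin T) => l _; apply: l. Qed.
Fact tensr_linear v : linear (tensr v).
Proof. by case: (tens_bilin T) => _ r; apply: r. Qed.
HB.instance Definition _ P := GRing.isLinear.Build C M T *:%R (tensl P) (tensl_linear P).
HB.instance Definition _ v := GRing.isLinear.Build C O T *:%R (tensr v) (tensr_linear v).

Lemma tens_suml (I : Type) (r : seq I) (F : I -> M) P :
  tens T (\sum_(i <- r) F i) P = \sum_(i <- r) tens T (F i) P.
Proof. exact: (linear_sum (tensl P)). Qed.

Lemma tens_sumr (I : Type) (r : seq I) v (F : I -> O) :
  tens T v (\sum_(i <- r) F i) = \sum_(i <- r) tens T v (F i).
Proof. exact: (linear_sum (tensr v)). Qed.

Lemma tensZl c v P : tens T (c *: v) P = c *: tens T v P.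
Proof. exact: (linearZ_LR (tensl P)). Qed.

Lemma tensZr c v P : tens T v (c *: P) = c *: tens T v P.
Proof. exact: (linearZ_LR (tensr v)). Qed.

Lemma tensDl v w P : tens T (v + w) P = tens T v P + tens T w P.
Proof. exact: (linearD (tensl P)). Qed.

Lemma tensDr v P Q : tens T v (P + Q) = tens T v P + tens T v Q.
Proof. exact: (linearD (tensr v)). Qed.

Lemma tensBr v P Q : tens T v (P - Q) = tens T v P - tens T v Q.
Proof. exact: (linearB (tensr v)). Qed.

Lemma tens0l P : tens T 0 P = 0.
Proof. exact: (linear0 (tensl P)). Qed.

Lemma tens0r v : tens T v 0 = 0.
Proof. exact: (linear0 (tensr v)). Qed.

Fact tcoef_subproof m : exists f : {linear T -> M},
  forall v P, f (tens T v P) = cf O m P *: v.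
Proof.
apply: (@tens_lift _ _ _ T M (fun v P => cf O m P *: v)).
split=> [P a u v|v a P Q]; first by rewrite scalerDr !scalerA mulrC.
by rewrite linearP scalerDl -scalerA.
Qed.

Definition tcoef m : {linear T -> M} := sval (cid (tcoef_subproof m)).

Lemma tcoef_tens m v P : tcoef m (tens T v P) = cf O m P *: v.
Proof. by rewrite /tcoef; case: (cid _). Qed.

Lemma tens_expand_ex t : exists A : {fset monom},
  (forall m, m \notin A -> tcoef m t = 0) /\
  t = \sum_(m <- A) tens T (tcoef m t) (mon O m).
Proof.
have widen (A A' : {fset monom}) u : (forall m, m \notin A -> tcoef m u = 0) ->
    \sum_(m <- A) tens T (tcoef m u) (mon O m) =
    \sum_(m <- (A `|` A')%fset) tens T (tcoef m u) (mon O m).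
  move=> uA; apply: big_fset_incl => [|m _ /uA ->]; last by rewrite tens0l.
  exact: fsubsetUl.
pose S := [set t : T | exists A : {fset monom},
  (forall m, m \notin A -> tcoef m t = 0) /\
  t = \sum_(m <- A) tens T (tcoef m t) (mon O m)].
apply: (@tensor_ind _ _ _ T S) => [|v P]; rewrite /S /=.
  split; first by exists fset0; split=> [m _|]; rewrite ?linear0 ?big_seq_fset0.
  move=> c t1 t2 [A [tA tE]] [A' [tA' tE']]; exists (A `|` A')%fset; split.
    move=> m; rewrite inE negb_or => /andP[/tA t1m /tA' t2m].
    by rewrite linearP t1m t2m scaler0 addr0.
  rewrite {1}tE {1}tE' (widen A A') // (widen A' A) // fsetUC scaler_sumr -big_split.
  by apply: eq_bigr => m _ /=; rewrite linearP /= tensDl tensZl.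
have [A PA PE] := mon_expand P.
exists A; split=> [m mA|]; first by rewrite tcoef_tens PA // scale0r.
rewrite {1}PE tens_sumr; apply: eq_bigr => m _.
by rewrite tcoef_tens tensZl tensZr.
Qed.

Lemma tcoef_supp t : exists A : {fset monom}, forall m, m \notin A -> tcoef m t = 0.
Proof. by have [A []] := tens_expand_ex t; exists A. Qed.

Lemma tens_expand (A : {fset monom}) t : (forall m, m \notin A -> tcoef m t = 0) ->
  t = \sum_(m <- A) tens T (tcoef m t) (mon O m).
Proof.
have [A' [tA' tE]] := tens_expand_ex t => tA.
rewrite {1}tE (_ : \sum_(m <- A') _ =
  \sum_(m <- (A' `|` A)%fset) tens T (tcoef m t) (mon O m)).
  apply/esym/big_fset_incl => [|m _ /tA ->]; last by rewrite tens0l.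
  exact: fsubsetUr.
apply: big_fset_incl => [|m _ /tA' ->]; last by rewrite tens0l.
exact: fsubsetUl.
Qed.

Lemma tens_mono_ind (S : set T) : subspace S ->
  (forall v m, S (tens T v (mon O m))) -> forall t, S t.
Proof.
move=> sS Sm t; have [A [_ ->]] := tens_expand_ex t.
by apply: subspace_sum => // m; apply: Sm.
Qed.

Section Form.
Variable K : M -> M -> C.
Hypotheses (K_linear : forall w, linear (K^~ w : M -> C^o))
           (K_herm : forall v w, K v w = (K w v)^*)
           (K_pos : forall v, v != 0 -> 0 < K v v).

(* The tensor product of K with the inner product on polynomials for which
   multiplication by x_a is adjoint to the derivation in x_a. *)
Definition tform t u : C :=
  \sum_(m \in [set: monom]) (mfact m)%:R * K (tcoef m t) (tcoef m u).

Lemma tformE (A : {fset monom}) t u : (forall m, m \notin A -> tcoef m t = 0) ->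
  tform t u = \sum_(m <- A) (mfact m)%:R * K (tcoef m t) (tcoef m u).
Proof.
by move=> tA; apply: fsbigTE => m /tA ->; rewrite (form0l K_linear) mulr0.
Qed.

Lemma tform_linear u : linear (tform^~ u : T -> C^o).
Proof.
move=> c t t'; have [A tA] := tcoef_supp t; have [A' tA'] := tcoef_supp t'.
have h m : m \notin (A `|` A')%fset -> tcoef m t = 0.
  by rewrite inE negb_or => /andP[/tA].
have h' m : m \notin (A `|` A')%fset -> tcoef m t' = 0.
  by rewrite inE negb_or => /andP[_ /tA'].
have h'' m : m \notin (A `|` A')%fset -> tcoef m (c *: t + t') = 0.
  by move=> mA; rewrite linearP /= h // h' // scaler0 addr0.
rewrite /= (tformE _ h) (tformE _ h') (tformE _ h'').
rewrite scaler_sumr -big_split; apply: eq_bigr => m _ /=.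
rewrite linearP (formDl K_linear) (formZl K_linear) mulrDr.
by rewrite [in RHS]/GRing.scale /= mulrCA.
Qed.

Lemma tform_herm t u : tform t u = (tform u t)^*.
Proof.
have [A tA] := tcoef_supp t; have [A' uA'] := tcoef_supp u.
have h m : m \notin (A `|` A')%fset -> tcoef m t = 0.
  by rewrite inE negb_or => /andP[/tA].
have h' m : m \notin (A `|` A')%fset -> tcoef m u = 0.
  by rewrite inE negb_or => /andP[_ /uA'].
rewrite (tformE _ h) (tformE _ h').
rewrite rmorph_sum; apply: eq_bigr => m _.
by rewrite rmorphM /= conjC_nat -K_herm.
Qed.

Lemma tform_pos t : t != 0 -> 0 < tform t t.
Proof.
have [A [tA tE]] := tens_expand_ex t => t0; rewrite (tformE t tA).
have ge0 m : 0 <= (mfact m)%:R * K (tcoef m t) (tcoef m t).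
  rewrite mulr_ge0 ?ler0n //; have [->|/K_pos/ltW//] := eqVneq (tcoef m t) 0.
  by rewrite (form0l K_linear).
rewrite lt_neqAle eq_sym sumr_ge0 ?andbT; last by move=> m _; apply: ge0.
apply: contra_neqN t0 => /eqP s0; rewrite tE big_seq big1 // => m mA.
move: s0; rewrite (big_fsetD1 m) //= => /eqP.
rewrite paddr_eq0 ?ge0 ?sumr_ge0 // => /andP[/eqP + _].
have [->|/K_pos Km] := eqVneq (tcoef m t) 0; first by rewrite tens0l.
by move/eqP; rewrite mulf_eq0 pnatr_eq0 (gt_eqF Km) orbF eqn0Ngt mfact_gt0.
Qed.

Lemma tform_mono t w m : tform t (tens T w (mon O m)) = (mfact m)%:R * K (tcoef m t) w.
Proof.
have [A tA] := tcoef_supp t.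
rewrite (@tformE (m |` A)%fset) => [|k]; last by rewrite !inE negb_or => /andP[_ /tA].
have mA : m \in (m |` A)%fset by rewrite !inE eqxx.
rewrite (big_fsetD1 m mA) big1_fset => [|k].
  by rewrite /= addr0 tcoef_tens cf_mon eqxx scale1r.
rewrite in_fsetD1 => /andP[km _] _.
by rewrite tcoef_tens cf_mon eq_sym (negPf km) scale0r (form0r K_linear K_herm) mulr0.
Qed.

End Form.
End TensorCoefficients.

Section TensorDirac.
Variables (R : realType) (J : choiceType) (M : lmodType R[i]).
Local Notation C := R[i].
Local Notation monom := {cmonom J}.
Variables (O : polynomials C J) (T : tensorProduct M O).
Implicit Types (m : monom) (t u : T) (v w : M) (P Q : O) (A : {fset J}).
Variables (X Y : J -> {linear M -> M}) (D d : {linear T -> T}).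
Hypotheses
  (Y_supp : forall v, exists A, forall a, a \notin A -> Y a v = 0)
  (DE : forall v P, D (tens T v P) =
     2 *: \sum_(a \in [set: J]) (tens T (X a v) (pd O a P) - tens T (Y a v) (xv O a * P)))
  (dE : forall v P, d (tens T v P) = \sum_(a \in [set: J]) tens T (Y a v) (xv O a * P)).

Lemma d_tens A v P : (forall a, a \notin A -> Y a v = 0) ->
  d (tens T v P) = \sum_(a <- A) tens T (Y a v) (xv O a * P).
Proof. by move=> vA; rewrite dE; apply: fsbigTE => a /vA ->; apply: tens0l. Qed.

Definition tdel t : T := locked (2^-1 *: D t + d t).

Fact tdel_linear : linear tdel.
Proof.
move=> c t u; rewrite /tdel -!lock (linearP D) (linearP d) !scalerDr addrACA.
by rewrite !scalerA mulrC.
Qed.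
HB.instance Definition _ := GRing.isLinear.Build C T T *:%R tdel tdel_linear.

Lemma D_tdel t : D t = 2 *: (tdel t - d t).
Proof. by rewrite /tdel -lock addrK scalerA divff ?scale1r // pnatr_eq0. Qed.

Lemma tdel_tens A v P : (forall a, a \notin A -> pd O a P = 0) ->
  tdel (tens T v P) = \sum_(a <- A) tens T (X a v) (pd O a P).
Proof.
move=> PA; have [B vB] := Y_supp v.
have h a : a \notin (A `|` B)%fset -> pd O a P = 0 /\ Y a v = 0.
  by rewrite in_fsetU negb_or => /andP[/PA -> /vB ->].
rewrite /tdel -lock DE scalerA mulVf ?pnatr_eq0 // scale1r.
rewrite (@fsbigTE _ _ _ _ (A `|` B)%fset) => [|a /h[-> ->]]; last first.
  by rewrite tens0l tens0r subr0.
rewrite sumrB (@d_tens (A `|` B)%fset) => [|a /h[]//]; rewrite subrK.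
apply/esym/big_fset_incl => [|a _ /PA ->]; last by rewrite tens0r.
exact: fsubsetUl.
Qed.

Hypothesis YY : forall a b v, Y a (Y b v) = - Y b (Y a v).

Lemma d_sqr t : d (d t) = 0.
Proof.
pose S := [set t | d (d t) = 0].
apply: (@tensor_ind _ _ _ T S) => [|v P]; rewrite /S /=.
  by split=> [|c t1 t2 /= e1 e2]; rewrite /= ?linear0 // !linearP e1 e2 scaler0 addr0.
have [A vA] := Y_supp v.
have [B hB] := uniform_support A (fun b => Y_supp (Y b v)).
pose E := (A `|` B)%fset.
have vE a : a \notin E -> Y a v = 0 by rewrite in_fsetU negb_or => /andP[/vA].
have YE b a : a \notin E -> Y a (Y b v) = 0.
  have [bA|/vA ->] := boolP (b \in A); last by rewrite linear0.
  by rewrite in_fsetU negb_or => /andP[_]; apply: hB.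
set s := d _.
have sE : s = \sum_(a <- E) \sum_(b <- E) tens T (Y b (Y a v)) (xv O b * (xv O a * P)).
  rewrite /s (d_tens P vE) linear_sum; apply: eq_bigr => a _.
  by apply: d_tens => b; apply: YE.
have sN : s = - s.
  rewrite {1}sE exchange_big sE -sumrN; apply: eq_bigr => a _ /=.
  rewrite -sumrN; apply: eq_bigr => b _ /=.
  by rewrite YY -[- Y _ _]scaleN1r tensZl scaleN1r mulrCA.
have : s *+ 2 = 0 by rewrite mulr2n {1}sN addNr.
by rewrite -scaler_nat => /eqP; rewrite scaler_eq0 pnatr_eq0 => /eqP.
Qed.

Section Adjoint.
Variable K : M -> M -> C.
Hypotheses (K_linear : forall w, linear (K^~ w : M -> C^o))
           (K_herm : forall v w, K v w = (K w v)^*)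
           (XY : forall a v w, K (X a v) w = - K v (Y a w)).

Let tl := tform_linear (T := T) K_linear.
Let th := tform_herm (T := T) K_linear K_herm.

Lemma tdel_adj t u : tform K (tdel t) u = - tform K t (d u).
Proof.
pose S u := [set t | tform K (tdel t) u = - tform K t (d u)].
apply: (@tens_mono_ind _ _ _ _ T [set u | S u t]) => [|w m] /=.
  split=> [|c u1 u2 e1 e2]; rewrite /S /= ?linear0 ?(form0r tl th) ?oppr0 //.
  rewrite (linearP d) !(formDr tl th) !(formZr tl th) e1 e2.
  by rewrite mulrN opprD.
apply: (@tensor_ind _ _ _ T (S _)) => [|v P]; rewrite /S /=.
  split=> [|c t1 t2 /= e1 e2]; rewrite /= ?linear0 ?(form0l tl) ?oppr0 //.
  rewrite (linearP tdel) !(formDl tl) !(formZl tl) e1 e2.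
  by rewrite mulrN opprD.
have [A PA] := pd_supp P; have [B wB] := Y_supp w.
have [PE wE] : (forall a, a \notin (A `|` B)%fset -> pd O a P = 0) /\
    (forall a, a \notin (A `|` B)%fset -> Y a w = 0).
  by split=> a; rewrite in_fsetU negb_or => /andP[/PA ? /wB].
rewrite (tdel_tens _ PE) (d_tens _ wE) (form_suml tl) (form_sumr tl th) -sumrN.
apply: eq_bigr => a _; rewrite xv_mon !tform_mono // !tcoef_tens.
rewrite !(formZl K_linear) XY cf_pd mfactM natrM.
by rewrite !mulrN; congr (- _); rewrite [_%:R * (mfact m)%:R]mulrC -!mulrA.
Qed.

End Adjoint.

Section Degree.
Variables (l : J -> nat) (Mdeg : int -> set M).
Hypotheses (l_gt0 : forall a, (0 < l a)%N)
  (l_fin : forall N, exists A, forall a, a \notin A -> (N < l a)%N)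
  (Mdeg_sub : forall k, subspace (Mdeg k))
  (Mdeg_fin : forall k, fin_dim (Mdeg k))
  (Mdeg_neg : forall (k : int) v, (k < 0)%R -> Mdeg k v -> v = 0)
  (Mdeg_span : forall S, subspace S -> (forall k, Mdeg k `<=` S) -> forall v, S v)
  (X_deg : forall k a v, Mdeg k v -> Mdeg (k + (l a)%:Z) (X a v))
  (Y_deg : forall k a v, Mdeg k v -> Mdeg (k - (l a)%:Z) (Y a v)).

Definition wt m : nat := (\sum_(a <- finsupp m) m a * l a)%N.

Lemma wtM a m : wt (mulcm (ucm a) m) = (l a + wt m)%N.
Proof.
have wtE A m' : (finsupp m' `<=` A)%fset -> wt m' = (\sum_(b <- A) m' b * l b)%N.
  by move=> mA; apply/big_fset_incl => // b _; rewrite -cmE_eq0 => /eqP ->.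
pose A := (a |` finsupp m)%fset.
have aA : a \in A by rewrite in_fset1U eqxx.
rewrite (wtE A) ?(wtE A m) ?fsubsetU1 //; last by rewrite (mdomD (ucm a) m) mdomU.
rewrite !(big_fsetD1 a aA) /= mulcmE ucmE eqxx mulnDl mul1n addnA; congr (_ + _)%N.
apply: eq_big_seq => b; rewrite in_fsetD1 => /andP[ba _].
by rewrite mulcmE ucmE eq_sym (negPf ba).
Qed.

Lemma monom_split a m : m a != 0%N -> m = mulcm (ucm a) (divcm m (ucm a)).
Proof.
move=> ma; apply/eqP/cmP => b; rewrite mulcmE divcmE ucmE subnKC //.
by case: eqP => // <-; rewrite lt0n.
Qed.

Lemma wt_fin N : exists A : {fset monom}, forall m, m \notin A -> (N < wt m)%N.
Proof.
elim: N => [|N [A hA]].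
  exists [fset onecm J]%fset => m; rewrite in_fset1 => m1.
  have [a ma] : exists a, m a != 0%N.
    apply: contrapT => m0; case/eqP: m1; apply/eqP/cmP => a; rewrite onecmE.
    by apply: contrapT => /eqP ma; apply: m0; exists a.
  by rewrite (monom_split ma) wtM ltn_addr.
have [B hB] := l_fin N.+1.
exists (onecm J |` [fset mulcm (ucm b) m | b in B, m in A])%fset => m.
rewrite in_fset1U negb_or => /andP[m1 mBA].
have [a ma] : exists a, m a != 0%N.
  apply: contrapT => m0; case/eqP: m1; apply/eqP/cmP => a; rewrite onecmE.
  by apply: contrapT => /eqP ma; apply: m0; exists a.
rewrite (monom_split ma) wtM.
have [aB|/hB aB] := boolP (a \in B); last exact: ltn_addr.
have [mA|/hA mA] := boolP (divcm m (ucm a) \in A); last first.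
  by rewrite -[N.+2]add1n leq_add ?l_gt0.
case/negP: mBA; apply/imfset2P; exists a => //.
by exists (divcm m (ucm a)) => //; apply: monom_split.
Qed.

Definition Tdeg (k : int) : set T := [set t | forall m, Mdeg (k - (wt m)%:Z) (tcoef T m t)].

Lemma Tdeg_sub k : subspace (Tdeg k).
Proof.
apply: subspace_bigcap => m.
exact: subspace_preim (linear_apply (tcoef T m)) (Mdeg_sub _).
Qed.

Lemma Tdeg_tens k v m : Mdeg (k - (wt m)%:Z) v -> Tdeg k (tens T v (mon O m)).
Proof.
move=> hv m'; rewrite tcoef_tens cf_mon; case: eqP => [<-|_]; first by rewrite scale1r.
by rewrite scale0r; case: (Mdeg_sub (k - (wt m')%:Z)).
Qed.

Lemma Tdeg_expand k : exists A : {fset monom}, forall t, Tdeg k t ->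
  t = \sum_(m <- A) tens T (tcoef T m t) (mon O m).
Proof.
have [A hA] := wt_fin `|k|%N; exists A => t tk; apply: tens_expand => m /hA wm.
apply: Mdeg_neg (tk m); rewrite subr_lt0.
by apply: le_lt_trans (ler_norm k) _; rewrite -abszE ltz_nat.
Qed.

Lemma Tdeg_fin k : fin_dim (Tdeg k).
Proof.
have [A hA] := Tdeg_expand k.
have := @fin_dim_sum _ M T _ A (fun m => tensl T (mon O m)) _ (fun m => Mdeg_fin (k - (wt m)%:Z)).
by apply: fin_dimS => t tk; exists (tcoef T ^~ t); split; [exact: tk|exact: hA].
Qed.

Lemma Tdeg_D k t : Tdeg k t -> Tdeg k (D t).
Proof.
have sT := Tdeg_sub k; have [A hA] := Tdeg_expand k => tk; rewrite (hA t tk) linear_sum.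
apply: (subspace_sum _ sT) => m; move: (tk m) => /=; set v := tcoef T m t => hv.
have [E1 hE1] := pd_supp (mon O m); have [E2 hE2] := Y_supp v.
rewrite D_tdel (tdel_tens _ hE1) (d_tens _ hE2).
apply: (subspaceZ _ sT).
apply: (subspaceB sT).
  apply: (subspace_sum _ sT) => a.
  rewrite pd_mon tensZr; have [->|ma] := eqVneq (m a) 0%N.
    by rewrite scale0r; case: sT.
  apply: (subspaceZ _ sT).
  apply: Tdeg_tens; have := X_deg a hv.
  by rewrite {1}(monom_split ma) wtM PoszD opprD addrA addrAC subrK.
apply: (subspace_sum _ sT) => a.
rewrite xv_mon; apply: Tdeg_tens; have := Y_deg a hv.
by rewrite wtM PoszD opprD addrA addrAC.
Qed.

Lemma tensor_dirac_split t : 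
  (forall u, D (D u) = 0 -> D u = 0) -> dirac_split D t.
Proof.
move=> Dsqr; apply: (@tens_mono_ind _ _ _ _ T (dirac_split D)) => [|v m].
  exact: dirac_split_subspace.
apply: (Mdeg_span (S := [set v | dirac_split D (tens T v (mon O m))])).
  apply: (@subspace_preim _ M T (tensl T (mon O m))); first exact: linear_apply.
  exact: dirac_split_subspace.
move=> k u ku.
apply: (dirac_split_fin_dim Dsqr (Tdeg_fin (k + (wt m)%:Z))); first exact: Tdeg_D.
by apply: Tdeg_tens; rewrite addrK.
Qed.

End Degree.
End TensorDirac.

Lemma sum_fset1 (V : nmodType) (J : choiceType) (A : {fset J}) (a : J) (F : J -> V) :
  (forall b, b != a -> F b = 0) -> (a \notin A -> F a = 0) ->
  \sum_(b <- A) F b = F a.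
Proof.
move=> F0 Fa; have [aA|/[dup] aA /Fa ->] := boolP (a \in A).
  rewrite (big_fsetD1 a aA) big1_fset /= ?addr0 // => b.
  by rewrite in_fsetD1 => /andP[/F0].
by rewrite big1_fset // => b bA _; apply: F0; apply: contraNneq aA => <-.
Qed.

Section EvenAction.
Variables (R : realType) (J : choiceType) (M : lmodType R[i]).
Local Notation C := R[i].
Variables (O : polynomials C J) (T : tensorProduct M O).
Implicit Types (t u : T) (v w : M) (P Q : O) (A : {fset J}).
Variables (X Y : J -> {linear M -> M}) (D d : {linear T -> T}).
Hypotheses
  (Y_supp : forall v, exists A, forall a, a \notin A -> Y a v = 0)
  (DE : forall v P, D (tens T v P) =
     2 *: \sum_(a \in [set: J]) (tens T (X a v) (pd O a P) - tens T (Y a v) (xv O a * P)))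
  (dE : forall v P, d (tens T v P) = \sum_(a \in [set: J]) tens T (Y a v) (xv O a * P)).
Variables (y : {linear M -> M}) (sy : O -> O) (ty : {linear T -> T}).
Variables (c : J -> J -> C) (row : J -> {fset J}).
Hypothesis row_c : forall a b, b \notin row a -> c a b = 0.

Definition row_form a : O := \sum_(b <- row a) c a b *: xv O b.

Hypotheses
  (syE : forall A P, (forall a, a \notin A -> pd O a P = 0) ->
     sy P = \sum_(a <- A) row_form a * pd O a P)
  (tyE : forall v P, ty (tens T v P) = tens T (y v) P + tens T v (sy P))
  (yY : forall a v A, (forall b, b \notin A -> Y b v = 0) ->
     y (Y a v) = Y a (y v) - \sum_(b <- A) c b a *: Y b v)
  (yX : forall a v, y (X a v) = X a (y v) + \sum_(b <- row a) c a b *: X b v).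

Lemma pd_row_form a b Q :
  pd O a (row_form b * Q) = c b a *: Q + row_form b * pd O a Q.
Proof.
rewrite /row_form mulr_suml linear_sum mulr_suml /=.
under eq_bigr => e _ do rewrite -scalerAl linearZ /= pd_xv scalerDr scalerA scalerAl.
rewrite big_split /=; congr (_ + _).
rewrite (@sum_fset1 _ _ _ a) ?eqxx ?mulr1 // => [b' b'a|/row_c ->].
  by rewrite eq_sym (negPf b'a) mulr0 scale0r.
by rewrite scale0r.
Qed.

Lemma sy_xv a P : sy (xv O a * P) = row_form a * P + xv O a * sy P.
Proof.
have [A PA] := pd_supp P.
have h b : b \notin (a |` A)%fset -> pd O b P = 0 /\ pd O b (xv O a * P) = 0.
  rewrite in_fset1U negb_or pd_xv => /andP[/negPf -> /PA ->].
  by rewrite scale0r mulr0 addr0.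
rewrite (@syE (a |` A)%fset) => [|b /h[]//].
rewrite [sy P](@syE (a |` A)%fset) => [|b /h[]//].
under eq_bigr => b _ do rewrite pd_xv mulrDr mulrCA.
rewrite big_split -mulr_sumr /=; congr (_ + _).
rewrite (@sum_fset1 _ _ _ a) ?eqxx ?scale1r // => [b /negPf ->|].
  by rewrite scale0r mulr0.
by rewrite in_fset1U eqxx.
Qed.

Lemma pd_sy a P A : (forall b, b \notin A -> pd O b P = 0) ->
  pd O a (sy P) = sy (pd O a P) + \sum_(b <- A) c b a *: pd O b P.
Proof.
move=> PA; rewrite (syE PA) (@syE A) => [|b /PA Pb]; last by rewrite pdC Pb linear0.
rewrite linear_sum -big_split; apply: eq_bigr => b _ /=.
by rewrite pd_row_form addrC pdC.
Qed.

Lemma ty_d t : ty (d t) = d (ty t).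
Proof.
pose S := [set t | ty (d t) = d (ty t)].
apply: (@tensor_ind _ _ _ T S) => [|v P]; rewrite /S /=.
  by split=> [|k t1 t2 /= e1 e2]; rewrite /= ?linear0 // !linearP e1 e2.
have [A1 vA1] := Y_supp v; have [A2 vA2] := Y_supp (y v).
have vA a : a \notin (A1 `|` A2)%fset -> Y a v = 0.
  by rewrite in_fsetU negb_or => /andP[/vA1].
have [B0 hB0] : exists B0 : {fset J},
    forall b a, b \in (A1 `|` A2)%fset -> a \notin B0 -> c b a = 0.
  by apply: uniform_support => b; exists (row b) => a /row_c.
pose B := (A1 `|` A2 `|` B0)%fset.
have vB a : a \notin B -> Y a v = 0 by rewrite in_fsetU negb_or => /andP[/vA].
have yvB a : a \notin B -> Y a (y v) = 0.
  by rewrite !in_fsetU !negb_or => /andP[/andP[_ /vA2]].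
have cB a b : a \notin B -> c b a *: Y b v = 0.
  rewrite in_fsetU negb_or => /andP[_ aB0].
  have [bA|/vA ->] := boolP (b \in (A1 `|` A2)%fset); last by rewrite scaler0.
  by rewrite (hB0 b a bA aB0) scale0r.
rewrite tyE linearD /= (d_tens dE P vB) (d_tens dE P yvB) (d_tens dE (sy P) vB) linear_sum.
under eq_bigr => a _ do rewrite /= tyE (yY a vB) sy_xv tensDl tensDr -addrA.
rewrite big_split /=; congr (_ + _).
under eq_bigr => a _ do rewrite addrA.
rewrite big_split /= -[RHS]add0r; congr (_ + _).
under eq_bigr => a _ do rewrite -scaleN1r tensZl scaleN1r tens_suml addrC.
rewrite sumrB; apply/eqP; rewrite subr_eq0; apply/eqP.
rewrite exchange_big /=; apply: eq_bigr => b _.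
rewrite /row_form mulr_suml tens_sumr; apply: esym.
under [RHS]eq_bigr => a _ do rewrite -scalerAl tensZr -tensZl.
have -> : \sum_(a <- row b) tens T (c b a *: Y b v) (xv O a * P) =
    \sum_(a <- (row b `|` B)%fset) tens T (c b a *: Y b v) (xv O a * P).
  apply: big_fset_incl => [|a _ /row_c ->]; first exact: fsubsetUl.
  by rewrite scale0r tens0l.
apply: big_fset_incl => [|a' _ a'B]; first exact: fsubsetUr.
by rewrite cB // tens0l.
Qed.

Lemma ty_tdel t : ty (tdel D d t) = tdel D d (ty t).
Proof.
pose S := [set t | ty (tdel D d t) = tdel D d (ty t)].
apply: (@tensor_ind _ _ _ T S) => [|v P]; rewrite /S /=.
  split=> [|k t1 t2 /= e1 e2]; rewrite /= ?linear0 //.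
  by rewrite (linearP (tdel D d)) !(linearP ty) (linearP (tdel D d)) e1 e2.
have [A1 PA1] := pd_supp P; have [A2 PA2] := pd_supp (sy P).
have [B0 hB0] : exists B0 : {fset J},
    forall b a, b \in (A1 `|` A2)%fset -> a \notin B0 -> c b a = 0.
  by apply: uniform_support => b; exists (row b) => a /row_c.
pose B := (A1 `|` A2 `|` B0)%fset.
have PA a : a \notin (A1 `|` A2)%fset -> pd O a P = 0.
  by rewrite in_fsetU negb_or => /andP[/PA1].
have PB a : a \notin B -> pd O a P = 0 by rewrite in_fsetU negb_or => /andP[/PA].
have sPB a : a \notin B -> pd O a (sy P) = 0.
  by rewrite !in_fsetU !negb_or => /andP[/andP[_ /PA2]].
have cB a b : a \notin B -> c b a *: pd O b P = 0.
  rewrite in_fsetU negb_or => /andP[_ aB0].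
  have [bA|/PA ->] := boolP (b \in (A1 `|` A2)%fset); last by rewrite scaler0.
  by rewrite (hB0 b a bA aB0) scale0r.
rewrite tyE linearD /= !(tdel_tens Y_supp DE dE _ PB) (tdel_tens Y_supp DE dE _ sPB).
rewrite linear_sum.
under eq_bigr => a _ do rewrite /= tyE yX tensDl -addrA.
rewrite big_split; congr (_ + _).
under [RHS]eq_bigr => a _ do rewrite (pd_sy a PB) tensDr.
rewrite !big_split /= addrC; congr (_ + _).
under eq_bigr => a _ do rewrite tens_suml.
under [RHS]eq_bigr => a _ do rewrite tens_sumr.
rewrite [RHS]exchange_big /=; apply: eq_bigr => a _.
have -> : \sum_(b <- row a) tens T (c a b *: X b v) (pd O a P) =
    \sum_(b <- (row a `|` B)%fset) tens T (c a b *: X b v) (pd O a P).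
  apply: big_fset_incl => [|b _ /row_c ->]; first exact: fsubsetUl.
  by rewrite scale0r tens0l.
under [RHS]eq_bigr => b _ do rewrite tensZr -tensZl.
apply/esym/big_fset_incl => [|b bB' bB]; first exact: fsubsetUr.
by rewrite tensZl -tensZr cB // tens0r.
Qed.

Lemma ty_D t : ty (D t) = D (ty t).
Proof. by rewrite !(D_tdel D d) linearZ linearB /= ty_tdel ty_d. Qed.

End EvenAction.

Section DiracCohomology.
Variables (R : realType) (J : choiceType) (M : lmodType R[i]).
Local Notation C := R[i].
Variables (O : polynomials C J) (T : tensorProduct M O).
Variables (X Y : J -> {linear M -> M}) (D d : {linear T -> T}) (K : M -> M -> C).
Variables (l : J -> nat) (Mdeg : int -> set M).
Hypotheses
  (Y_supp : forall v, exists A : {fset J}, forall a, a \notin A -> Y a v = 0)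
  (DE : forall v P, D (tens T v P) =
     2 *: \sum_(a \in [set: J]) (tens T (X a v) (pd O a P) - tens T (Y a v) (xv O a * P)))
  (dE : forall v P, d (tens T v P) = \sum_(a \in [set: J]) tens T (Y a v) (xv O a * P))
  (YY : forall a b v, Y a (Y b v) = - Y b (Y a v))
  (K_linear : forall w, linear (K^~ w : M -> C^o))
  (K_herm : forall v w, K v w = (K w v)^*)
  (K_pos : forall v, v != 0 -> 0 < K v v)
  (XY : forall a v w, K (X a v) w = - K v (Y a w))
  (l_gt0 : forall a, (0 < l a)%N)
  (l_fin : forall N, exists A : {fset J}, forall a, a \notin A -> (N < l a)%N)
  (Mdeg_sub : forall k, subspace (Mdeg k))
  (Mdeg_fin : forall k, fin_dim (Mdeg k))
  (Mdeg_neg : forall (k : int) v, k < 0 -> Mdeg k v -> v = 0)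
  (Mdeg_span : forall S, subspace S -> (forall k, Mdeg k `<=` S) -> forall v, S v)
  (X_deg : forall k a v, Mdeg k v -> Mdeg (k + (l a)%:Z) (X a v))
  (Y_deg : forall k a v, Mdeg k v -> Mdeg (k - (l a)%:Z) (Y a v)).

Lemma dirac_cohomology : exists f : {linear kernel D -> cohomology d},
  bijective f /\ forall t z, f t = coclass z <-> exists s, d s = ker_val t - ker_val z.
Proof.
have S_linear := tform_linear (T := T) K_linear.
have S_herm := tform_herm (T := T) K_linear K_herm.
have S_pos := tform_pos (T := T) K_linear K_pos.
have S_adj := tdel_adj Y_supp DE dE K_linear K_herm XY.
have dd := d_sqr Y_supp dE YY.
have Dsqr := dirac_ker_sqr S_linear S_herm S_pos S_adj (D_tdel D d).
have split_all t : dirac_split D t.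
  exact: (tensor_dirac_split Y_supp DE dE l_gt0 l_fin Mdeg_sub Mdeg_fin Mdeg_neg
    Mdeg_span X_deg Y_deg).
exists (dirac_class S_linear S_herm S_pos S_adj (D_tdel D d) dd).
by split; [apply: dirac_class_bij|apply: dirac_class_eq].
Qed.

End DiracCohomology.

(** * Lie superalgebras and their modules *)

Arguments evpart {R s}.

Section SuperBasics.
Variables (R : realType).
Local Notation C := R[i].

Section Space.
Variable V : superSpace R.
Implicit Types (u v : V) (b : bool).

Lemma parity_ev v : parity false (evpart v).
Proof. exact: evpart_idem. Qed.

Lemma parity_odd v : parity true (v - evpart v).
Proof. by rewrite /parity /= linearB /= evpart_idem subrr. Qed.

Lemma ev_odd v : evpart v + (v - evpart v) = v.
Proof. by rewrite addrC subrK. Qed.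

Lemma parity_homog (P : V -> Prop) b v : parity b v -> P 0 -> P v ->
  P (evpart v) /\ P (v - evpart v).
Proof. by rewrite /parity /=; case: b => ->; rewrite ?subrr ?subr0. Qed.

Lemma parity_ind (S : set V) : (forall u v, S u -> S v -> S (u + v)) ->
  (forall b v, parity b v -> S v) -> forall v, S v.
Proof.
move=> SD Sh v; rewrite -[v]ev_odd; apply: SD; apply: Sh.
  exact: parity_ev.
exact: parity_odd.
Qed.

Fact psign_linear : linear (@psign R V).
Proof.
move=> c u v; rewrite /psign (linearP evpart) mulrnDl scalerBr scalerMnr opprD.
by rewrite addrACA.
Qed.
HB.instance Definition _ := GRing.isLinear.Build C V V *:%R (@psign R V) psign_linear.

Lemma psign_parity b v : parity b v -> psign v = (-1) ^+ b *: v.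
Proof.
rewrite /parity /psign /=; case: b => ->; first by rewrite mul0rn sub0r expr1 scaleN1r.
by rewrite mulr2n addrK expr0 scale1r.
Qed.

Lemma psignK v : psign (psign v) = v.
Proof.
rewrite /psign linearB linearMn /= evpart_idem !mulr2n addrK opprB.
by rewrite addrCA subrr addr0.
Qed.

End Space.

Section Bracket.
Variable g : lieSuper R.
Implicit Types (x y z : g).

Definition brl x : g -> g := br x.
Definition brr y : g -> g := fun x => br x y.
Fact brl_linear x : linear (brl x).
Proof. by case: (br_bilin g) => _ h; apply: h. Qed.
Fact brr_linear y : linear (brr y).
Proof. by case: (br_bilin g) => h _; apply: h. Qed.
HB.instance Definition _ x := GRing.isLinear.Build C g g *:%R (brl x) (brl_linear x).
HB.instance Definition _ x := GRing.isLinear.Build C g g *:%R (brr x) (brr_linear x).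

Lemma brDr x y z : br x (y + z) = br x y + br x z.
Proof. exact: (linearD (brl x)). Qed.
Lemma brDl x y z : br (x + y) z = br x z + br y z.
Proof. exact: (linearD (brr z)). Qed.
Lemma brZr x a y : br x (a *: y) = a *: br x y.
Proof. exact: (linearZ_LR (brl x)). Qed.
Lemma brZl a x y : br (a *: x) y = a *: br x y.
Proof. exact: (linearZ_LR (brr y)). Qed.
Lemma br0r x : br x 0 = 0.
Proof. exact: (linear0 (brl x)). Qed.
Lemma br0l y : br 0 y = 0.
Proof. exact: (linear0 (brr y)). Qed.
Lemma br_suml (I : Type) (r : seq I) (F : I -> g) y :
  br (\sum_(i <- r) F i) y = \sum_(i <- r) br (F i) y.
Proof. exact: (linear_sum (brr y)). Qed.
Lemma jacobi_even x y z : parity false x ->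
  br x (br y z) = br (br x y) z + br y (br x z).
Proof.
move=> x0; move: y; apply: parity_ind => [u v|b y yb].
  by rewrite !brDr !brDl brDr => -> ->; rewrite addrACA.
by rewrite (br_jacobi z x0 yb) expr0 scale1r.
Qed.

Lemma skew_even x y : parity false x -> br x y = - br y x.
Proof.
move=> x0; move: y; apply: parity_ind => [u v|b y yb].
  by rewrite brDr brDl => -> ->; rewrite opprD.
by rewrite (br_skew x0 yb) expr0 scale1r.
Qed.

Lemma ev_br x y :
  evpart (br x y) = br (evpart x) (evpart y) + br (x - evpart x) (y - evpart y).
Proof.
rewrite -{1}[x]ev_odd -{1}[y]ev_odd.
move: (evpart x) (evpart y) (x - _) (y - _) (parity_ev x) (parity_ev y)
  (parity_odd x) (parity_odd y) => x0 y0 x1 y1 hx0 hy0 hx1 hy1.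
rewrite brDl !brDr !linearD /=.
have /= -> := br_parity hx0 hy0; have /= -> := br_parity hx0 hy1.
by have /= -> := br_parity hx1 hy0; have /= -> := br_parity hx1 hy1; rewrite addr0 add0r.
Qed.

Lemma odd_br x y : br x y - evpart (br x y) =
  br (evpart x) (y - evpart y) + br (x - evpart x) (evpart y).
Proof.
rewrite ev_br -{1}[x]ev_odd -{1}[y]ev_odd.
move: (evpart x) (evpart y) (x - _) (y - _) => x0 y0 x1 y1; rewrite brDl !brDr.
apply/eqP; rewrite subr_eq -!addrA; apply/eqP; rewrite addrCA; congr (_ + _).
by rewrite [RHS]addrCA [br x0 y0 + _]addrC -!addrA; congr (_ + _); rewrite addrC.
Qed.

End Bracket.

Section Action.
Variables (g : lieSuper R) (M : superModule g).
Implicit Types (x y : g) (v w : M).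

Definition actl x : M -> M := act x.
Definition actr v : g -> M := fun x => act x v.
Fact actl_linear x : linear (actl x).
Proof. by case: (act_bilin M) => _ h; apply: h. Qed.
Fact actr_linear v : linear (actr v).
Proof. by case: (act_bilin M) => h _; apply: h. Qed.
HB.instance Definition _ x := GRing.isLinear.Build C M M *:%R (actl x) (actl_linear x).
HB.instance Definition _ v := GRing.isLinear.Build C g M *:%R (actr v) (actr_linear v).

Lemma actDr x v w : act x (v + w) = act x v + act x w.
Proof. exact: (linearD (actl x)). Qed.
Lemma actDl x y v : act (x + y) v = act x v + act y v.
Proof. exact: (linearD (actr v)). Qed.
Lemma actZr x a v : act x (a *: v) = a *: act x v.
Proof. exact: (linearZ_LR (actl x)). Qed.
Lemma actZl a x v : act (a *: x) v = a *: act x v.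
Proof. exact: (linearZ_LR (actr v)). Qed.
Lemma act0r x : act x 0 = 0 :> M.
Proof. exact: (linear0 (actl x)). Qed.
Lemma act0l v : act 0 v = 0.
Proof. exact: (linear0 (actr v)). Qed.
Lemma act_suml (I : Type) (r : seq I) (F : I -> g) v :
  act (\sum_(i <- r) F i) v = \sum_(i <- r) act (F i) v.
Proof. exact: (linear_sum (actr v)). Qed.
Lemma psign_act a x v : parity a x -> psign (act x v) = (-1) ^+ a *: act x (psign v).
Proof.
move=> xa; move: v; apply: parity_ind => [u v|b v vb].
  rewrite actDr (linearD (@psign R M) (act x u)) (linearD (@psign R M) u).
  by rewrite /= => -> ->; rewrite (actDr x (psign u)) scalerDr.
rewrite (psign_parity (act_parity xa vb)) (psign_parity vb) actZr scalerA.
by rewrite signr_addb.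
Qed.

Lemma act_br_even x y v : parity false x ->
  act (br x y) v = act x (act y v) - act y (act x v).
Proof.
move=> x0; move: y; apply: parity_ind => [y z|b y yb].
  by rewrite brDr !actDl actDr => -> ->; rewrite opprD addrACA.
by rewrite (act_br v x0 yb) expr0 scale1r.
Qed.

End Action.
End SuperBasics.

Section Grading.
Variables (R : realType) (G : cartanDatum R) (g : lieSuper R) (e : generators G g).
Local Notation C := R[i].
Local Notation n := (rank_ G).
Implicit Types (x y z : g).

Lemma kac_moody_chevalley : kac_moody e -> chevalley_relations e /\ generating e.
Proof.
case=> [[_ [gt [et [q [[[c1 c2 c3 c4 c5] gen _] [[qev qbr] qh qXY] qsurj _ _]]]]] _ _ _].
have qpar b (x : gt) : parity b x -> parity b (q x).
  by rewrite /parity /= -qev => ->; case: b; rewrite ?linear0.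
split.
  split.
  - by move=> t; rewrite -qh; apply: qpar.
  - by move=> i; have [<- <-] := qXY i; case: (c2 i) => ? ?; split; apply: qpar.
  - move=> t i; have [<- <-] := qXY i; rewrite -qh -!qbr.
    by case: (c3 t i) => -> ->; rewrite linearN !linearZ.
  - move=> i j; have [<- _] := qXY i; have [_ <-] := qXY j; rewrite -qbr c4.
    by case: eqP => _; rewrite ?linear0 ?qh.
  - by move=> s t; rewrite -!qh -qbr c5 linear0.
apply/seteqP; split=> // x _ S sS Sbr Sgen.
have [x' _ <-] : range q x by rewrite qsurj.
have : [set: gt] x' by [].
rewrite -gen => /(_ (q @^-1` S)); apply.
- exact: subspace_preim (linear_apply q) sS.
- by move=> y z /= Sy Sz; rewrite qbr; apply: Sbr.
- move=> _ [[|]|] [t _ <-] /=; apply: Sgen.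
  + by left; left; exists t; rewrite ?qh.
  + by left; right; exists t; rewrite ?(qXY t).1.
  + by right; exists t; rewrite ?(qXY t).2.
Qed.

Lemma sroot_dual : exists t : cartan G, forall i : 'I_n, sroot i t = 1.
Proof.
pose b := vbasis {: cartan G}.
pose N := \matrix_(i < n, j < \dim {: cartan G}) (sroot i b`_j : C).
have : row_free N.
  rewrite -kermx_eq0; apply/eqP/row_matrixP => k; rewrite row0.
  have := sub_kermxP (row_sub k (kermx N)).
  set r := row k _ => rN.
  have r0 : \sum_(i < n) r 0 i *: sroot i = 0.
    apply/lfunP => t; rewrite sum_lfunE zero_lfunE.
    rewrite (coord_vbasis (memvf t)).
    under eq_bigr => i _ do rewrite scale_lfunE linear_sum scaler_sumr.
    rewrite exchange_big big1 // => j _.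
    have := congr1 (fun m : 'rV_ _ => m 0 j) rN; rewrite !mxE => rNj.
    rewrite (_ : \sum_(i < n) _ = coord b j t *: \sum_i r 0 i * N i j).
      by rewrite rNj scaler0.
    rewrite scaler_sumr; apply: eq_bigr => i _.
    by rewrite linearZ /= [N i j]mxE /GRing.scale /= mulrCA.
  have fr : free (map_tuple (@sroot R G) (ord_tuple n)).
    by move: (sroot_free G); rewrite codomE.
  apply/rowP => i; rewrite [RHS]mxE; have /freeP := fr; apply.
  rewrite -[RHS]r0; apply: eq_bigr => j _; congr (_ *: _).
  by rewrite (nth_map j) ?size_enum_ord // nth_ord_enum.
case/row_freeP => N' NN'.
exists (\sum_(j < \dim {: cartan G}) (N' *m const_mx 1 : 'cV_ _) j 0 *: b`_j) => i.
rewrite linear_sum /=.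
have := congr1 (fun m : 'M_(n, n) => (m *m (const_mx 1 : 'cV_n)) i 0) NN'.
rewrite mul1mx -mulmxA [RHS]mxE mxE => E; rewrite -[RHS]E; apply: eq_bigr => j _.
by rewrite linearZ /= [N i j]mxE mulrC.
Qed.

End Grading.

(** * The principal grading *)

Section PositivePart.
Variables (R : realType) (G : cartanDatum R) (g : lieSuper R) (e : generators G g).
Local Notation C := R[i].
Local Notation n := (rank_ G).
Implicit Types (x y z : g).
Hypothesis chev : chevalley_relations e.
Variable t0 : cartan G.
Hypothesis t0_sroot : forall i : 'I_n, sroot i t0 = 1.

Lemma hin_even t : parity false (hin e t).
Proof. by case: chev. Qed.

Lemma gX_parity i : parity (par i) (gX e i).
Proof. by case: chev => _ /(_ i)[]. Qed.

Lemma gY_parity i : parity (par i) (gY e i).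
Proof. by case: chev => _ /(_ i)[]. Qed.

Lemma br_hin_X t i : br (hin e t) (gX e i) = sroot i t *: gX e i.
Proof. by case: chev => _ _ /(_ t i)[]. Qed.

Lemma br_hin_Y t i : br (hin e t) (gY e i) = - (sroot i t *: gY e i).
Proof. by case: chev => _ _ /(_ t i)[]. Qed.

Definition eigen (lam : C) : set g := [set x | br (hin e t0) x = lam *: x].

Lemma eigen_sub lam : subspace (eigen lam).
Proof.
split; first by rewrite /eigen /= br0r scaler0.
move=> c u v; rewrite /eigen /= brDr brZr => -> ->.
by rewrite scalerDr !scalerA mulrC.
Qed.

Lemma eigen_br lam mu x y : eigen lam x -> eigen mu y -> eigen (lam + mu) (br x y).
Proof.
rewrite /eigen /= => ex ey; rewrite (jacobi_even _ _ (hin_even _)) ex ey.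
by rewrite brZl brZr scalerDl.
Qed.

Lemma eigen_X i : eigen 1 (gX e i).
Proof. by rewrite /eigen /= br_hin_X t0_sroot. Qed.

Lemma principal_eigen k x : principal e k x -> eigen k%:~R x.
Proof.
move=> h; apply: (h (fun k => eigen k%:~R)).
- by move=> j; apply: eigen_sub.
- by move=> j l y z ey ez; rewrite intrD; apply: eigen_br.
- by move=> t; rewrite /eigen /= scale0r; case: chev.
- move=> i; split; first exact: eigen_X.
  by rewrite /eigen /= br_hin_Y t0_sroot mulrN1z scaleN1r scale1r.
Qed.

Fixpoint xdeg (k : nat) : set g :=
  if k is k'.+1 then
    [set x | exists u : 'I_n -> g,
       (forall i, xdeg k' (u i)) /\ x = \sum_i br (gX e i) (u i)]
  else lspan [seq gX e i | i <- enum 'I_n].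

Lemma xdeg_sub k : subspace (xdeg k).
Proof.
elim: k => [|k IH]; first exact: lspan_subspace.
split.
  exists (fun=> 0); split=> [i|]; first by case: IH.
  by rewrite big1 // => i _; rewrite br0r.
move=> c _ _ [u [hu ->]] [v [hv ->]]; exists (fun i => c *: u i + v i); split=> [i|].
  by case: IH => _ h; apply: h; [exact: hu|exact: hv].
rewrite scaler_sumr -big_split; apply: eq_bigr => i _ /=.
by rewrite brDr brZr.
Qed.

Lemma xdeg_fin k : fin_dim (xdeg k).
Proof.
elim: k => [|k IH]; first by exists [seq gX e i | i <- enum 'I_n].
exact: (fin_dim_sum (index_enum 'I_n) (fun i => brl (gX e i)) (fun=> IH)).
Qed.

Lemma xdeg_X i : xdeg 0 (gX e i).
Proof. by apply/lspan_mem/mapP; exists i; rewrite ?mem_enum. Qed.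

Lemma xdeg_brX k i u : xdeg k u -> xdeg k.+1 (br (gX e i) u).
Proof.
move=> hu; exists (fun j => if j == i then u else 0); split=> [j|].
  by case: eqP => _ //; case: (xdeg_sub k).
rewrite (bigD1 i) //= eqxx big1 ?addr0 // => j /negPf ->.
by rewrite br0r.
Qed.

Lemma xdeg_ev k x : xdeg k x -> xdeg k (evpart x).
Proof.
elim: k x => [|k IH] x.
  apply: (lspan_sub (S := [set x | xdeg 0 (evpart x)])) => [|_ /mapP[i _ ->]].
    exact: subspace_preim (linear_apply evpart) (xdeg_sub 0).
  have s0 : xdeg 0 0 by case: (xdeg_sub 0).
  by have [] := parity_homog (P := xdeg 0) (gX_parity i) s0 (xdeg_X i).
case=> u [hu ->]; rewrite linear_sum; apply: (subspace_sum _ (xdeg_sub k.+1)) => i.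
rewrite ev_br.
have [eX oX] : (forall z, xdeg k z -> xdeg k.+1 (br (evpart (gX e i)) z)) /\
    (forall z, xdeg k z -> xdeg k.+1 (br (gX e i - evpart (gX e i)) z)).
  apply: (parity_homog (P := fun x => forall z, xdeg k z -> xdeg k.+1 (br x z)) (gX_parity i)).
    by move=> z _; rewrite br0l; case: (xdeg_sub k.+1).
  by move=> z; apply: xdeg_brX.
apply: (subspaceD (xdeg_sub k.+1)); first exact/eX/IH/hu.
apply/oX/(subspaceB (xdeg_sub k)); first exact: hu.
exact/IH/hu.
Qed.

Lemma xdeg_br j k x y : xdeg j x -> xdeg k y -> xdeg (j + k).+1 (br x y).
Proof.
elim: j k x y => [|j IH] k x y.
  move=> hx hy; move: hx.
  apply: (lspan_sub (S := [set x | xdeg k.+1 (br x y)])) => [|_ /mapP[i _ ->]].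
    exact: subspace_preim (brr_linear y) (xdeg_sub _).
  exact: xdeg_brX.
case=> u [hu ->] hy; rewrite br_suml; apply: (subspace_sum _ (xdeg_sub _)) => i.
have homog b v : parity b v -> xdeg j v -> xdeg (j.+1 + k).+1 (br (br (gX e i) v) y).
  move=> vb hv; have -> : br (br (gX e i) v) y = br (gX e i) (br v y)
      - (-1) ^+ (par i && b) *: br v (br (gX e i) y).
    by rewrite (br_jacobi y (gX_parity i) vb) addrK.
  apply: (subspaceB (xdeg_sub (j.+1 + k).+1)).
    by rewrite addSn; apply/xdeg_brX/IH.
  apply: (subspaceZ _ (xdeg_sub (j.+1 + k).+1)).
  by rewrite addSnnS; apply: IH => //; apply: xdeg_brX.
have hui : xdeg j (u i) by apply: hu.
rewrite -[u i]ev_odd brDr brDl; apply: (subspaceD (xdeg_sub (j.+1 + k).+1)).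
  exact: homog (parity_ev _) (xdeg_ev hui).
exact: homog (parity_odd _) (subspaceB (xdeg_sub j) hui (xdeg_ev hui)).
Qed.

Lemma xdeg_eigen k x : xdeg k x -> eigen k.+1%:R x.
Proof.
elim: k x => [|k IH] x.
  apply: lspan_sub => [|_ /mapP[i _ ->]]; first exact: eigen_sub.
  exact: eigen_X.
case=> u [hu ->]; apply: subspace_sum => [|i]; first exact: eigen_sub.
rewrite -[k.+2]add1n natrD; apply: eigen_br; first exact: eigen_X.
exact/IH/hu.
Qed.

Definition xspan : set g :=
  [set x | forall S : set g, subspace S -> (forall k, xdeg k `<=` S) -> S x].

Lemma npos_xspan : npos e `<=` xspan.
Proof.
move=> x h; apply: (h xspan).
- split=> [S []//|c u v hu hv S sS kS].
  by case: (sS) => _ h'; apply: h'; [apply: hu|apply: hv].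
- move=> y z hy hz S sS kS.
  apply: (hy [set y | S (br y z)]).
    exact: subspace_preim (brr_linear z) sS.
  move=> j y' hy'; apply: (hz [set z | S (br y' z)]).
    exact: subspace_preim (brl_linear y') sS.
  by move=> k z' hz'; apply: (kS (j + k).+1); apply: xdeg_br.
- by move=> _ [i _ <-] S sS kS; apply: (kS 0%N); apply: xdeg_X.
Qed.

Lemma xspan_sum x : xspan x -> exists (N : nat) (u : nat -> g),
  [/\ forall k, xdeg k (u k), forall k, (N <= k)%N -> u k = 0
    & x = \sum_(k < N) u k].
Proof.
pose S := [set x : g | exists (N : nat) (u : nat -> g),
  [/\ forall k, xdeg k (u k), forall k, (N <= k)%N -> u k = 0
    & x = \sum_(k < N) u k]].
have widen N N' (u : nat -> g) : (forall k, (N <= k)%N -> u k = 0) -> (N <= N')%N ->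
    \sum_(k < N) u k = \sum_(k < N') u k.
  move=> u0 le; rewrite (big_ord_widen N' u le) big_mkcond; apply: eq_bigr => k _.
  by case: ltnP => // /u0.
move=> hx; apply: (hx S) => [|k v hv].
  split.
    exists 0%N, (fun=> 0); split=> // [k|]; last by rewrite big_ord0.
    by case: (xdeg_sub k).
  move=> c _ _ [N [u [hu u0 ->]]] [N' [u' [hu' u0' ->]]].
  exists (maxn N N'), (fun k => c *: u k + u' k); split=> [k|k|].
  - by case: (xdeg_sub k) => _ h; apply: h; [exact: hu|exact: hu'].
  - by rewrite geq_max => /andP[/u0 -> /u0' ->]; rewrite scaler0 addr0.
  - rewrite (widen N (maxn N N')) ?leq_maxl // (widen N' (maxn N N')) ?leq_maxr //.
    by rewrite scaler_sumr -big_split.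
exists k.+1, (fun j => if j == k then v else 0); split=> [j|j|].
- by case: eqP => [->//|_]; case: (xdeg_sub j).
- by move=> kj; rewrite gtn_eqF.
- rewrite big_ord_recr /= eqxx big1 ?add0r // => i _.
  by rewrite ltn_eqF.
Qed.

Lemma npos_eigen (l : int) x : npos e x -> eigen l%:~R x ->
  x = 0 \/ exists2 k, l = k.+1%:Z & xdeg k x.
Proof.
move=> /npos_xspan/xspan_sum [N [u [hu u0 xE]]] ex.
have uE k : brl (hin e t0) (u k) = k.+1%:R *: u k by apply: xdeg_eigen.
have [l0|l0] := leP l 0.
  left; pose lam (o : option nat) : C := if o is Some k then k.+1%:R else l%:~R.
  pose v (o : option nat) : g := if o is Some k then u k else - x.
  have lam_inj : injective lam.
    have lk k : (l%:~R : C) = k.+1%:R -> False.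
      rewrite -[k.+1%:R]/(k.+1%:Z%:~R) => /intr_inj lk.
      by rewrite lk in l0.
    case=> [j|] [k|] //=.
    - by move/eqP; rewrite eqr_nat => /eqP [->].
    - by move/esym/lk.
    - by move/lk.
  have vE o : brl (hin e t0) (v o) = lam o *: v o.
    case: o => [k|] /=; first exact: uE.
    by rewrite -scaleN1r [LHS]brZr ex !scaleN1r scalerN.
  pose s := None :: [seq Some k | k <- iota 0 N].
  have us : uniq s.
    rewrite /= map_inj_uniq ?iota_uniq ?andbT => [|? ? []//].
    by apply/mapP => -[].
  have := eigen_sum_eq0 lam_inj us vE.
  rewrite big_cons big_map /= => /(_ _ None (mem_head _ _)) h.
  apply: oppr_inj; rewrite oppr0; apply: h.
  by rewrite {1}xE -(big_mkord xpredT u) /index_iota subn0 addNr.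
right; case: l ex l0 => // -[//|k] ex _; exists k => //.
pose v (j : nat) : g := if j == k then u k - x else u j.
have lam_inj : injective (fun k : nat => k.+1%:R : C).
  by move=> i j /eqP; rewrite eqr_nat => /eqP [].
have vE j : brl (hin e t0) (v j) = j.+1%:R *: v j.
  rewrite /v; case: eqP => [->|_]; last exact: uE.
  by rewrite linearB /= uE scalerBr; congr (_ - _).
pose N' := maxn N k.+1.
have := eigen_sum_eq0 lam_inj (iota_uniq 0 N') vE.
have kN : k \in iota 0 N' by rewrite mem_iota add0n /= leq_maxr.
have -> : \sum_(j <- iota 0 N') v j = 0.
  have -> : \sum_(j <- iota 0 N') v j =
      \sum_(j <- iota 0 N') u j - \sum_(j <- iota 0 N') (if j == k then x else 0).
    rewrite -sumrB; apply: eq_bigr => j _; rewrite /v.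
    by case: eqP => [->//|_]; rewrite subr0.
  rewrite [X in _ - X](bigD1_seq k) ?iota_uniq //= eqxx [X in _ - (_ + X)]big1; last first.
    by move=> j /negPf ->.
  rewrite addr0.
  apply/eqP; rewrite subr_eq0 xE; apply/eqP.
  have -> : iota 0 N' = index_iota 0 N' by rewrite /index_iota subn0.
  rewrite big_mkord (big_ord_widen N' u (leq_maxl _ _)) [RHS]big_mkcond.
  by apply: eq_bigr => j _; case: ltnP => // /u0.
move=> /(_ erefl k kN) /eqP; rewrite /v eqxx subr_eq0 => /eqP <-.
exact: hu.
Qed.

End PositivePart.

Section ModuleDegree.
Variables (R : realType) (G : cartanDatum R) (g : lieSuper R) (e : generators G g).
Local Notation C := R[i].
Local Notation n := (rank_ G).
Hypotheses (chev : chevalley_relations e) (gen : generating e).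
Variables (M : superModule g) (La : weight G) (vLa : M).
Hypothesis hw : highest_weight e setT setT La vLa.
Implicit Types (x y z : g) (v w : M).

Definition ymul (S : set M) : set M :=
  [set v | exists u : 'I_n -> M, (forall i, S (u i)) /\ v = \sum_i act (gY e i) (u i)].

(* Both vLa and its image under the parity are included, since vLa is not assumed
   to be homogeneous. *)
Definition ydeg (k : nat) : set M := iter k ymul (lspan [:: vLa; psign vLa]).

Arguments ydeg : simpl never.

Lemma ydeg_sub k : subspace (ydeg k).
Proof.
elim: k => [|k IH]; first exact: lspan_subspace.
split.
  exists (fun=> 0); split=> [i|]; first by case: IH.
  by rewrite big1 // => i _; rewrite act0r.
move=> c _ _ [u [hu ->]] [v [hv ->]]; exists (fun i => c *: u i + v i); split=> [i|].
  by case: IH => _ h; apply: h; [exact: hu|exact: hv].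
rewrite scaler_sumr -big_split; apply: eq_bigr => i _ /=.
by rewrite actDr actZr.
Qed.

Lemma ydeg_fin k : fin_dim (ydeg k).
Proof.
elim: k => [|k IH]; first by exists [:: vLa; psign vLa].
exact: (fin_dim_sum (index_enum 'I_n) (fun i => @actl _ _ M (gY e i)) (fun=> IH)).
Qed.

Lemma ydeg_Y k i u : ydeg k u -> ydeg k.+1 (act (gY e i) u).
Proof.
move=> hu; exists (fun j => if j == i then u else 0); split=> [j|].
  by case: eqP => _ //; case: (ydeg_sub k).
rewrite (bigD1 i) //= eqxx big1 ?addr0 // => j /negPf ->.
by rewrite act0r.
Qed.

Lemma ydeg_ind (S : set M) k : subspace S ->
  (forall i u, ydeg k u -> S (act (gY e i) u)) -> ydeg k.+1 `<=` S.
Proof.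
move=> sS SY _ [u [hu ->]]; apply: subspace_sum => // i; exact/SY/hu.
Qed.

Lemma ydeg0_ind (S : set M) : subspace S -> S vLa -> S (psign vLa) -> ydeg 0 `<=` S.
Proof.
move=> sS S1 S2; apply: lspan_sub => // v; rewrite !in_cons in_nil orbF.
by case/orP => /eqP ->.
Qed.

Lemma ydeg0_vLa : ydeg 0 vLa.
Proof. by apply: lspan_mem; rewrite in_cons eqxx. Qed.

Lemma ydeg0_psign : ydeg 0 (psign vLa).
Proof. by apply: lspan_mem; rewrite !in_cons eqxx orbT. Qed.

Lemma ydeg_psign k v : ydeg k v -> ydeg k (psign v).
Proof.
have sub k' := subspace_preim (linear_apply (@psign R M)) (ydeg_sub k').
elim: k v => [|k IH].
  apply: (ydeg0_ind (sub 0%N)) => /=; first exact: ydeg0_psign.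
  by rewrite psignK; apply: ydeg0_vLa.
apply: (ydeg_ind (sub k.+1)) => i u hu /=.
rewrite (psign_act _ (gY_parity chev i)).
by apply: (subspaceZ _ (ydeg_sub k.+1)); apply/ydeg_Y/IH.
Qed.

Lemma act_hin_vLa t : act (hin e t) vLa = La t *: vLa.
Proof. by case: (hw_vector hw) => _ _ /(_ t). Qed.

Lemma act_gX_vLa i : act (gX e i) vLa = 0.
Proof.
case: (hw_vector hw) => _ _ _; apply => // S _ _; apply.
by exists i.
Qed.

Lemma ydeg_hin k t v : ydeg k v -> ydeg k (act (hin e t) v).
Proof.
have sub k' := subspace_preim (@actl_linear _ _ M (hin e t)) (ydeg_sub k').
elim: k v => [|k IH].
  apply: (ydeg0_ind (sub 0%N)) => /=; rewrite /actl.
    rewrite act_hin_vLa; exact: subspaceZ (ydeg_sub 0) ydeg0_vLa.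
  have := psign_act vLa (hin_even chev t); rewrite expr0 scale1r => <-.
  apply: ydeg_psign; rewrite act_hin_vLa; exact: subspaceZ (ydeg_sub 0) ydeg0_vLa.
apply: (ydeg_ind (sub k.+1)) => i u hu /=; rewrite /actl.
have := act_br_even (gY e i) u (hin_even chev t).
rewrite (br_hin_Y chev) => /eqP; rewrite eq_sym subr_eq => /eqP ->.
apply: (subspaceD (ydeg_sub k.+1)); last exact/ydeg_Y/IH.
rewrite -scaleN1r actZl actZl; apply: (subspaceZ _ (ydeg_sub k.+1)).
by apply: (subspaceZ _ (ydeg_sub k.+1)); apply: ydeg_Y.
Qed.

Definition hwdeg (k : int) : set M := if k is Posz k' then ydeg k' else [set 0].

Lemma hwdeg_sub k : subspace (hwdeg k).
Proof.
case: k => k; first exact: ydeg_sub.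
by split=> // a u v /= -> ->; rewrite scaler0 addr0.
Qed.

Lemma hwdeg_fin k : fin_dim (hwdeg k).
Proof. by case: k => k; [apply: ydeg_fin|exists [::]]. Qed.

Lemma hwdeg_neg (k : int) v : k < 0 -> hwdeg k v -> v = 0.
Proof. by case: k. Qed.

Lemma hwdeg_psign k v : hwdeg k v -> hwdeg k (psign v).
Proof. by case: k => k; [apply: ydeg_psign|move=> /= ->; rewrite (linear0 (@psign R M))]. Qed.

Definition lowers (l : int) x : Prop := forall k v, hwdeg k v -> hwdeg (k - l) (act x v).

Lemma lowers_sub l : subspace (lowers l).
Proof.
split=> [k v _|c x y hx hy k v kv]; first by rewrite act0l; case: (hwdeg_sub (k - l)).
by rewrite actDl actZl; case: (hwdeg_sub (k - l)) => _ h; apply: h; [apply: hx|apply: hy].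
Qed.

Lemma lowers_hin t : lowers 0 (hin e t).
Proof.
move=> k v; rewrite subr0; case: k => k; first exact: ydeg_hin.
by move=> /= ->; rewrite act0r.
Qed.

Lemma lowers_Y i : lowers (-1) (gY e i).
Proof.
move=> [k|k] v kv; rewrite opprK; first by rewrite -PoszD addn1; apply: ydeg_Y.
by rewrite kv act0r; case: (hwdeg_sub (Negz k + 1)).
Qed.

Lemma lowers_X i : lowers 1 (gX e i).
Proof.
have sub k := subspace_preim (@actl_linear _ _ M (gX e i)) (hwdeg_sub k).
move=> [k|k] v; last by move=> ->; rewrite act0r; case: (hwdeg_sub (Negz k - 1)).
elim: k v => [|k IH].
  apply: (ydeg0_ind (sub (0 - 1))) => /=; rewrite /actl; first exact: act_gX_vLa.
  have := psign_act vLa (gX_parity chev i); rewrite act_gX_vLa (linear0 (@psign R M)).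
  by move/esym/eqP; rewrite scaler_eq0 signr_eq0 => /eqP.
apply: (ydeg_ind (sub (k.+1%:Z - 1))) => j u hu.
change (hwdeg (k.+1%:Z - 1) (act (gX e i) (act (gY e j) u))).
have -> : k.+1%:Z - 1 = k by rewrite -addn1 PoszD addrK.
have := act_br u (gX_parity chev i) (gY_parity chev j).
move/eqP; rewrite eq_sym subr_eq => /eqP ->; apply: (subspaceD (ydeg_sub k)).
  case: chev => _ _ _ -> _; case: eqP => _; first exact: ydeg_hin.
  by rewrite act0l; case: (ydeg_sub k).
apply: (subspaceZ _ (ydeg_sub k)).
case: k u hu IH => [|k] u hu IH; last first.
  apply: ydeg_Y; have := IH _ hu.
  by rewrite -[k.+1]addn1 PoszD addrK.
by have /= -> := IH _ hu; rewrite act0r; case: (ydeg_sub 0).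
Qed.

Lemma lowers_br a b j l y z : parity a y -> parity b z ->
  lowers j y -> lowers l z -> lowers (j + l) (br y z).
Proof.
move=> ya zb hy hz k v kv; rewrite (act_br v ya zb); apply: (subspaceB (hwdeg_sub _)).
  by rewrite [j + l]addrC opprD addrA; apply/hy/hz.
by apply: (subspaceZ _ (hwdeg_sub _)); rewrite opprD addrA; apply/hz/hy.
Qed.

Lemma principal_lowers l x : principal e l x -> lowers l x.
Proof.
pose S l : set g := [set x | lowers l (evpart x) /\ lowers l (x - evpart x)].
have homog b j y : parity b y -> lowers j y -> S j y.
  by move=> yb hy; apply: (parity_homog yb) => //; case: (lowers_sub j).
suff /[apply] [[he ho]] : principal e l x -> S l x.
  by rewrite -[x]ev_odd; apply: (subspaceD (lowers_sub l)).
move=> h; apply: (h S).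
- move=> j; split; first by rewrite /S /= linear0 subr0; case: (lowers_sub j).
  move=> c y z [y0 y1] [z0 z1]; have [_ sL] := lowers_sub j.
  split; rewrite /= linearP; first exact: sL.
  by rewrite opprD addrACA -scalerBr; apply: sL.
- move=> j k y z [y0 y1] [z0 z1]; split; rewrite ?odd_br ?ev_br.
    apply: (subspaceD (lowers_sub (j + k))).
      exact: lowers_br (parity_ev _) (parity_ev _) y0 z0.
    exact: lowers_br (parity_odd _) (parity_odd _) y1 z1.
  apply: (subspaceD (lowers_sub (j + k))).
    exact: lowers_br (parity_ev _) (parity_odd _) y0 z1.
  exact: lowers_br (parity_odd _) (parity_ev _) y1 z0.
- by move=> t; apply: homog (hin_even chev t) (lowers_hin t).
- move=> i; split; first exact: homog (gX_parity chev i) (lowers_X i).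
  exact: homog (gY_parity chev i) (lowers_Y i).
Qed.

Lemma hwdeg_span (S : set M) : subspace S -> (forall k, hwdeg k `<=` S) -> forall v, S v.
Proof.
pose U := [set v | forall S : set M, subspace S -> (forall k, hwdeg k `<=` S) -> S v].
have sU : subspace U.
  split=> [S' []//|c u v hu hv S' sS kS].
  by case: (sS) => _ h; apply: h; [apply: hu|apply: hv].
pose st x := forall v, U v -> U (act x v).
have st_sub : subspace st.
  split=> [v _|c x y hx hy v Uv]; first by rewrite act0l; case: sU.
  by rewrite actDl actZl; case: sU => _ h; apply: h; [apply: hx|apply: hy].
have st_lowers l x : lowers l x -> st x.
  move=> hx v Uv S' sS kS; apply: (Uv [set v | S' (act x v)]).
    exact: subspace_preim (actl_linear x) sS.
  by move=> k u ku; apply: (kS (k - l)); apply: hx.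
have st_br a b y z : parity a y -> parity b z -> st y -> st z -> st (br y z).
  move=> ya zb hy hz v Uv; rewrite (act_br v ya zb); apply: (subspaceB sU).
    exact: hy (hz _ Uv).
  exact: subspaceZ sU (hz _ (hy _ Uv)).
pose W := [set x | st (evpart x) /\ st (x - evpart x)].
have homog b y : parity b y -> st y -> W y.
  by move=> yb hy; apply: (parity_homog yb) => //; case: st_sub.
have stx x : st x.
  suff [he ho] : W x by rewrite -[x]ev_odd; apply: (subspaceD st_sub).
  have : [set: g] x by [].
  rewrite -gen => /(_ W); apply.
  - split; first by rewrite /W /= linear0 subr0; case: st_sub.
    move=> c y z [y0 y1] [z0 z1]; have [_ sL] := st_sub.
    split; rewrite /= linearP; first exact: sL.
    by rewrite opprD addrACA -scalerBr; apply: sL.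
  - move=> y z [y0 y1] [z0 z1]; split; rewrite ?odd_br ?ev_br; apply: (subspaceD st_sub).
    + exact: st_br (parity_ev _) (parity_ev _) y0 z0.
    + exact: st_br (parity_odd _) (parity_odd _) y1 z1.
    + exact: st_br (parity_ev _) (parity_odd _) y0 z1.
    + exact: st_br (parity_odd _) (parity_ev _) y1 z0.
  - move=> _ [[|]|] [i _ <-].
    + exact: homog (hin_even chev i) (st_lowers _ _ (lowers_hin i)).
    + exact: homog (gX_parity chev i) (st_lowers _ _ (lowers_X i)).
    + exact: homog (gY_parity chev i) (st_lowers _ _ (lowers_Y i)).
move=> sS kS v; apply: (hw_generated hw sU) => //.
  by move=> x u _; apply: stx.
by move=> S' _ kS'; apply: (kS' 0); apply: ydeg0_vLa.
Qed.

End ModuleDegree.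

(** * Dual bases and the oscillator action *)

Section DualBases.
Variables (R : realType) (G : cartanDatum R) (g : lieSuper R) (e : generators G g).
Local Notation C := R[i].
Local Notation n := (rank_ G).
Implicit Types (y z : g).
Hypothesis chev : chevalley_relations e.
Variables (eps : 'I_n -> C) (B : g -> g -> C).
Hypothesis B_form : standard_form e eps B.
Variables (J : choiceType) (x del : J -> g).
Hypothesis bases : dual_bases e B x del.

Lemma B_linear_l z : linear (B^~ z : g -> C^o).
Proof. by case: (form_bilin B_form) => h _; apply: h. Qed.

Lemma B_linear_r z : linear (B z : g -> C^o).
Proof. by case: (form_bilin B_form) => _ h; apply: h. Qed.

Definition B_l z : {linear g -> C^o} :=
  HB.pack (B^~ z : g -> C^o) (GRing.isLinear.Build C g C^o *:%R _ (B_linear_l z)).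
Definition B_r z : {linear g -> C^o} :=
  HB.pack (B z : g -> C^o) (GRing.isLinear.Build C g C^o *:%R _ (B_linear_r z)).

Lemma BZl a y z : B (a *: y) z = a * B y z.
Proof. exact: (linearZ_LR (B_l z)). Qed.
Lemma BZr a y z : B y (a *: z) = a * B y z.
Proof. exact: (linearZ_LR (B_r y)). Qed.
Lemma BNl y z : B (- y) z = - B y z.
Proof. exact: (linearN (B_l z)). Qed.

Lemma x_gminus a : gminus e (x a). Proof. by case: bases => -[]. Qed.
Lemma del_gplus a : gplus e (del a). Proof. by case: bases => _ []. Qed.
Lemma B_del_x a b : B (del a) (x b) = if a == b then 2^-1 else 0.
Proof. by case: bases. Qed.

Lemma B_del_x2 a b : 2 * B (del a) (x b) = (a == b)%:R.
Proof.
by rewrite B_del_x; case: eqP => _; rewrite ?mulr0 // mulfV // pnatr_eq0.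
Qed.

Section Eigen.
Variable t0 : cartan G.
Hypothesis t0_sroot : forall i : 'I_n, sroot i t0 = 1.
Local Notation eigen := (eigen e t0).

Lemma B_eigen (k l : int) y z : eigen k%:~R y -> eigen l%:~R z -> k + l != 0 -> B y z = 0.
Proof.
rewrite /eigen /= => ey ez kl.
have : B (br (hin e t0) y) z = - B y (br (hin e t0) z).
  by rewrite (skew_even _ (hin_even chev t0)) BNl (form_inv B_form).
rewrite ey ez BZl BZr => /eqP; rewrite -subr_eq0 opprK -mulrDl -intrD mulf_eq0.
by rewrite intr_eq0 (negPf kl) => /eqP.
Qed.

Lemma dual_degree a : exists k : nat,
  [/\ xdeg e k (del a), principal e k.+1%:Z (del a) & principal e (- k.+1%:Z) (x a)].
Proof.
have [k [l [pk pl]]] : exists k l, principal e k (x a) /\ principal e l (del a).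
  by case: bases => _ _ /(_ a).
have ek := principal_eigen chev t0_sroot pk.
have el := principal_eigen chev t0_sroot pl.
have Bne : B (del a) (x a) != 0 by rewrite B_del_x eqxx invr_eq0 pnatr_eq0.
have [_ npl] := del_gplus a.
have [d0|[m lE xm]] := npos_eigen chev t0_sroot npl el.
  by case/eqP: Bne; rewrite d0 -(scale0r 0) BZl mul0r.
exists m; split=> //; first by rewrite -lE.
suff -> : - m.+1%:Z = k by [].
rewrite -lE; apply/eqP; rewrite eq_sym -subr_eq0 opprK addrC.
by apply: contraNT Bne => kl; apply/eqP/(B_eigen el ek).
Qed.

Lemma dual_degree_fin k : exists A : {fset J}, forall a, xdeg e k (del a) -> a \in A.
Proof.
apply: contrapT => nA; have [w hw] := xdeg_fin e k.
have inf : infinite_set [set a | xdeg e k (del a)].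
  move=> /finite_fsetP [A AE]; apply: nA; exists A => a ha.
  by have : [set a | xdeg e k (del a)] a by []; rewrite AE.
have [A /= AX As] := infinite_set_fset (size w).+1 inf.
pose t := in_tuple (enum_fset A).
have hu (i : 'I_(size A)) : lspan w (del (tnth t i)).
  by apply/hw/AX; apply: mem_tnth.
have [c [[i ci] c0]] := lspan_dependent As hu.
pose c' a : C := if insub (index a (enum_fset A)) is Some i then c i else 0.
have c'E j : c' (tnth t j) = c j.
  rewrite /c' (tnth_nth (tnth t i)) index_uniq ?fset_uniq //.
  by rewrite valK.
case: bases => _ [_ ind _] _ _.
have := ind (enum_fset A) c' (fset_uniq A).
have -> : \sum_(a <- enum_fset A) c' a *: del a = 0.
  rewrite big_tnth -[RHS]c0; apply: eq_bigr => j _; congr (_ *: _).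
  exact: c'E.
move=> /(_ erefl (tnth t i) (mem_tnth _ _)); rewrite c'E => ci0.
by rewrite ci0 eqxx in ci.
Qed.

Lemma dual_degrees : exists l : J -> nat,
  [/\ forall a, (0 < l a)%N, forall a, principal e (l a) (del a),
      forall a, principal e (- (l a)%:Z) (x a)
    & forall N, exists A : {fset J}, forall a, a \notin A -> (N < l a)%N].
Proof.
have [k hk] := choice dual_degree; exists (fun a => (k a).+1).
split=> [//|a|a|]; [by case: (hk a)|by case: (hk a)|].
elim=> [|N [A hA]]; first by exists fset0.
have [A' hA'] := dual_degree_fin N; exists (A `|` A')%fset => a.
rewrite in_fsetU negb_or => /andP[/hA]; rewrite leq_eqVlt => /orP[/eqP NE|//].
have [xk _ _] := hk a; have NE' : N = k a by case: NE.
by rewrite NE' in hA' *; rewrite hA'.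
Qed.

Lemma B_x_x a b : B (x a) (x b) = 0.
Proof.
have [k [_ _ pk]] := dual_degree a; have [l [_ _ pl]] := dual_degree b.
apply: (B_eigen (principal_eigen chev t0_sroot pk) (principal_eigen chev t0_sroot pl)).
by rewrite -opprD oppr_eq0 -PoszD addSn.
Qed.

Lemma B_del_del a b : B (del a) (del b) = 0.
Proof.
have [k [_ pk _]] := dual_degree a; have [l [_ pl _]] := dual_degree b.
apply: (B_eigen (principal_eigen chev t0_sroot pk) (principal_eigen chev t0_sroot pl)).
by rewrite -PoszD addSn.
Qed.

End Eigen.

Lemma phi_x_linear b : linear (fun z => 2 * B (del b) z : C^o).
Proof. by move=> c y z; rewrite B_linear_r mulrDr scalerAr. Qed.

Lemma phi_del_linear b : linear (fun z => 2 * B z (x b) : C^o).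
Proof. by move=> c y z; rewrite B_linear_l mulrDr scalerAr. Qed.

Lemma gminus_expand z : gminus e z -> exists2 A : {fset J},
  forall b, b \notin A -> 2 * B (del b) z = 0
  & z = \sum_(b <- A) (2 * B (del b) z) *: x b.
Proof.
case: bases => bx _ _ _; apply: (basis_expand bx phi_x_linear) => a b.
by rewrite B_del_x2 eq_sym.
Qed.

Lemma gplus_expand z : gplus e z -> exists2 A : {fset J},
  forall b, b \notin A -> 2 * B z (x b) = 0
  & z = \sum_(b <- A) (2 * B z (x b)) *: del b.
Proof.
case: bases => _ bd _ _; apply: (basis_expand bd phi_del_linear) => a b.
exact: B_del_x2.
Qed.

Lemma B_del_br z a b : gbar0 z -> B (br z (del a)) (x b) = - B (del a) (br z (x b)).
Proof. by move=> z0; rewrite (skew_even _ z0) BNl (form_inv B_form). Qed.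

End DualBases.

Section NormalOrder.
Variables (R : realType) (J : choiceType).
Local Notation C := R[i].
Variable O : polynomials C J.
Variables (c : J -> J -> C) (row : J -> {fset J}).
Hypothesis row_c : forall a b, b \notin row a -> c a b = 0.
Implicit Types (A : {fset J}) (P : O).

Lemma row_form_fsum a : \sum_(b \in [set: J]) c a b *: xv O b = row_form O c row a.
Proof. by apply: fsbigTE => b /row_c ->; rewrite scale0r. Qed.

Lemma row_derivation_fsum A P : (forall a, a \notin A -> pd O a P = 0) ->
  \sum_(a \in [set: J]) row_form O c row a * pd O a P =
  \sum_(a <- A) row_form O c row a * pd O a P.
Proof. by move=> PA; apply: fsbigTE => a /PA ->; rewrite mulr0. Qed.

Lemma row_transpose A P : (forall a, a \notin A -> pd O a P = 0) ->
  \sum_(a \in [set: J]) xv O a * (\sum_(b \in [set: J]) (- c b a) *: pd O b P) =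
  - \sum_(a <- A) row_form O c row a * pd O a P.
Proof.
move=> PA; have [E hE] : exists E : {fset J}, forall b a, b \in A -> a \notin E -> c b a = 0.
  by apply: uniform_support => b; exists (row b) => a /row_c.
have inner a : \sum_(b \in [set: J]) (- c b a) *: pd O b P =
    \sum_(b <- A) (- c b a) *: pd O b P.
  by apply: fsbigTE => b /PA ->; rewrite scaler0.
rewrite (@fsbigTE _ _ _ _ E) => [|a aE]; last first.
  rewrite inner big_seq big1 ?mulr0 // => b bA.
  by rewrite (hE b a bA aE) oppr0 scale0r.
under eq_bigr => a _ do rewrite inner mulr_sumr.
rewrite exchange_big -sumrN; apply: eq_big_seq => b bA /=.
rewrite /row_form mulr_suml -sumrN.
have -> : \sum_(a <- row b) - (c b a *: xv O a * pd O b P) =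
    \sum_(a <- (row b `|` E)%fset) - (c b a *: xv O a * pd O b P).
  apply: big_fset_incl => [|a _ /row_c ->]; first exact: fsubsetUl.
  by rewrite scale0r mul0r oppr0.
under eq_bigr => a _ do rewrite -scalerAr scaleNr scalerAl.
apply: big_fset_incl => [|a _ aE]; first exact: fsubsetUr.
by rewrite (hE b a bA aE) scale0r mul0r oppr0.
Qed.

End NormalOrder.

Section OscillatorAction.
Variables (R : realType) (G : cartanDatum R) (g : lieSuper R) (e : generators G g).
Local Notation C := R[i].
Local Notation n := (rank_ G).
Implicit Types (y z : g).
Hypothesis chev : chevalley_relations e.
Variables (eps : 'I_n -> C) (B : g -> g -> C).
Hypothesis B_form : standard_form e eps B.
Variables (J : choiceType) (x del : J -> g).
Hypothesis bases : dual_bases e B x del.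
Hypotheses (minus_stable : g0_stable (gminus e)) (plus_stable : g0_stable (gplus e)).
Variable t0 : cartan G.
Hypothesis t0_sroot : forall i : 'I_n, sroot i t0 = 1.
Local Notation O := (oscillator_polynomials R J).

Let adm z a b : C := 2 * B (del b) (br z (x a)).

Lemma br_x_gminus z a : gbar0 z -> gminus e (br z (x a)).
Proof. by move=> z0; apply: minus_stable z0 (x_gminus bases a). Qed.

Lemma br_del_gplus z a : gbar0 z -> gplus e (br z (del a)).
Proof. by move=> z0; apply: plus_stable z0 (del_gplus bases a). Qed.

Lemma B_br_x_x z a b : gbar0 z -> B (br z (x a)) (x b) = 0.
Proof.
move=> z0; have [A _ ->] := gminus_expand B_form bases (br_x_gminus a z0).
rewrite -[LHS]/(B_l B_form (x b) _) linear_sum big1 // => a' _.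
by rewrite linearZ /= (B_x_x chev B_form bases t0_sroot) scaler0.
Qed.

Lemma B_del_br_del z a b : gbar0 z -> B (del b) (br z (del a)) = 0.
Proof.
move=> z0; have [A _ ->] := gplus_expand B_form bases (br_del_gplus a z0).
rewrite -[LHS]/(B_r B_form (del b) _) linear_sum big1 // => a' _.
by rewrite linearZ /= (B_del_del chev B_form bases t0_sroot) scaler0.
Qed.

Lemma adm_rows z : gbar0 z -> exists row : J -> {fset J},
  (forall a b, b \notin row a -> adm z a b = 0) /\
  forall a, br z (x a) = \sum_(b <- row a) adm z a b *: x b.
Proof.
move=> z0.
have h a : exists A : {fset J}, (forall b, b \notin A -> adm z a b = 0) /\
    br z (x a) = \sum_(b <- A) adm z a b *: x b.
  by have [A ? ?] := gminus_expand B_form bases (br_x_gminus a z0); exists A.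
by have [row hrow] := choice h; exists row; split=> a; case: (hrow a).
Qed.

Lemma adm_transpose z a b : gbar0 z -> 2 * B (br z (del a)) (x b) = - adm z b a.
Proof. by move=> z0; rewrite (B_del_br B_form x del a b z0) mulrN. Qed.

Section Rows.
Variables (z : g) (row : J -> {fset J}).
Hypotheses (z0 : gbar0 z) (row_c : forall a b, b \notin row a -> adm z a b = 0).

Lemma symmetric_act_row (A : {fset J}) (P : O) : (forall a, a \notin A -> pd O a P = 0) ->
  symmetric_act B x del z P = \sum_(a <- A) row_form O (adm z) row a * pd O a P.
Proof.
move=> PA; apply: etrans (row_derivation_fsum _ _ PA).
apply: eq_fsbigr => a _; congr (_ * _).
exact: (row_form_fsum O row_c a).
Qed.

Lemma oscillator_act_row (rho1 : g -> C) (P : oscillator R J) :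
  oscillator_act B x del rho1 z P = symmetric_act B x del z P - rho1 z *: P.
Proof.
have [A PA] := pd_supp (O := O) P.
have e1 : \sum_(a \in [set: J]) normal_del B x del (br z (x a)) a P =
    symmetric_act B x del z P.
  apply: eq_fsbigr => a _; rewrite /normal_del.
  rewrite (_ : cl_plus B x (br z (x a)) _ = 0) ?addr0 //.
  by apply: fsbig1 => b _; rewrite (B_br_x_x _ _ z0) mulr0 scale0r.
have e2 : \sum_(a \in [set: J]) normal_x B x del (br z (del a)) a P =
    - symmetric_act B x del z P.
  rewrite (symmetric_act_row PA).
  apply: etrans (row_transpose row_c PA).
  apply: eq_fsbigr => a _; rewrite /normal_x.
  rewrite (_ : cl_minus B del (br z (del a)) = 0) ?mul0r ?add0r; last first.
    by apply: fsbig1 => b _; rewrite (B_del_br_del _ _ z0) mulr0 scale0r.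
  apply: (congr1 (fun Q : oscillator R J => xvar R a * Q)).
  by apply: eq_fsbigr => b _; rewrite (adm_transpose _ _ z0).
rewrite /oscillator_act e1 e2 scalerN opprK -scalerDl.
have -> : 2^-1 + 2^-1 = 1 :> C by rewrite -mulr2n -[LHS]mulr_natl mulfV // pnatr_eq0.
by rewrite scale1r.
Qed.

End Rows.

Section Tensor.
Variables (M : superModule g) (T : tensorProduct M (oscillator R J)).
Variables (pi tau : g -> {linear T -> T}) (D d : {linear T -> T}) (rho1 : g -> C).
Hypotheses (pi_def : oscillator_tensor_action B x del rho1 pi)
           (tau_def : cochain_action B x del tau)
           (D_def : dirac_operator x del D) (d_def : coboundary del d).

Lemma oscillator_tensor_actE z t : gbar0 z -> pi z t = tau z t - rho1 z *: t.
Proof.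
move=> z0; have [row [row_c _]] := adm_rows z0.
pose S := [set t | pi z t = tau z t - rho1 z *: t].
apply: (tensor_ind (S := S)) => [|v P]; rewrite /S /=.
  split=> [|c t1 t2 /= e1 e2].
    by rewrite /= (linear0 (pi z)) (linear0 (tau z)) scaler0 subr0.
  rewrite (linearP (pi z)) (linearP (tau z)) e1 e2 scalerBr scalerDr opprD addrACA.
  by rewrite !scalerA [c * _]mulrC.
rewrite pi_def // tau_def // -addrA (oscillator_act_row z0 row_c); congr (_ + _).
by rewrite (tensBr (O := O)) (tensZr (O := O)).
Qed.

Definition sact y (v : M) : M := act y (psign v).

Fact sact_linear y : linear (sact y).
Proof. by move=> c u v; rewrite /sact (linearP (@psign R M)) actDr actZr. Qed.
HB.instance Definition _ y := GRing.isLinear.Build C M M *:%R (sact y) (sact_linear y).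

Lemma act_sact z y v : gbar0 z -> act z (sact y v) = sact y (act z v) + sact (br z y) v.
Proof.
move=> z0; rewrite /sact (psign_act (a := false) _ z0) expr0 scale1r.
by rewrite (act_br_even y _ z0) addrC subrK.
Qed.

Lemma sact_suml (r : seq J) (F : J -> g) v :
  sact (\sum_(a <- r) F a) v = \sum_(a <- r) sact (F a) v.
Proof. exact: act_suml. Qed.

Lemma sactZl a y v : sact (a *: y) v = a *: sact y v.
Proof. exact: actZl. Qed.

Lemma act_sact_del z a v (A : {fset J}) : gbar0 z ->
  (forall b, b \notin A -> sact (del b) v = 0) ->
  act z (sact (del a) v) = sact (del a) (act z v)
    - \sum_(b <- A) adm z b a *: sact (del b) v.
Proof.
move=> z0 vA; rewrite act_sact //; congr (_ + _).
have [E Ec ->] := gplus_expand B_form bases (br_del_gplus a z0).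
rewrite sact_suml -sumrN.
transitivity (\sum_(b <- (E `|` A)%fset) (2 * B (br z (del a)) (x b)) *: sact (del b) v).
  under eq_bigr => b _ do rewrite sactZl.
  apply: big_fset_incl => [|b _ /Ec ->]; first exact: fsubsetUl.
  by rewrite scale0r.
under eq_bigr => b _ do rewrite (adm_transpose _ _ z0) scaleNr.
apply/esym/big_fset_incl => [|b _ bA]; first exact: fsubsetUr.
by rewrite vA // scaler0 oppr0.
Qed.

Hypothesis del_supp : forall v, exists A : {fset J}, forall a, a \notin A -> sact (del a) v = 0.

Let X a : {linear M -> M} := sact (x a).
Let Y a : {linear M -> M} := sact (del a).

Lemma dirac_sact v (P : O) : D (tens T v P) = 2 *: \sum_(a \in [set: J])
  (tens T (X a v) (pd O a P) - tens T (Y a v) (xv O a * P)).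
Proof. exact: D_def. Qed.

Lemma coboundary_sact v (P : O) :
  d (tens T v P) = \sum_(a \in [set: J]) tens T (Y a v) (xv O a * P).
Proof. exact: d_def. Qed.

Lemma cochain_act_commutes z : gbar0 z ->
  (forall t, tau z (d t) = d (tau z t)) /\ (forall t, tau z (D t) = D (tau z t)).
Proof.
move=> z0; have [row [row_c rowE]] := adm_rows z0.
have syE A (P : O) := @symmetric_act_row z row row_c A P.
have tyE v (P : O) : tau z (tens T v P) =
    tens T (actl (M := M) z v) P + tens T v (symmetric_act B x del z P).
  exact: tau_def.
have yY a v A := @act_sact_del z a v A z0.
have yX a v : actl (M := M) z (X a v) =
    X a (actl z v) + \sum_(b <- row a) adm z a b *: X b v.
  rewrite -[LHS]/(act z (sact (x a) v)) act_sact //; congr (_ + _).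
  by rewrite [br z _]rowE sact_suml; apply: eq_bigr => b _; rewrite sactZl.
split=> t; first exact: (ty_d del_supp coboundary_sact row_c syE tyE yY).
exact: (ty_D del_supp dirac_sact coboundary_sact row_c syE tyE yY yX).
Qed.

End Tensor.
End OscillatorAction.

(* Averaging the contravariant form over the parity makes the even and odd parts of
   M orthogonal, so that the parity signs are self-adjoint. *)
Lemma parity_averaged_form (R : realType) (g : lieSuper R) (M : superModule g)
    (om : g -> g) (v0 : M) : unitarizable om v0 ->
  exists K : M -> M -> R[i],
  [/\ forall w, linear (K^~ w : M -> R[i]^o), forall v w, K v w = (K w v)^*,
      forall v, v != 0 -> 0 < K v v
    & forall y, parity true y -> parity true (om y) ->
      forall v w, K (sact y v) w = - K v (sact (om y) w)].
Proof.
case=> H [H_lin H_herm _ H_inv] H_pos.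
exists (fun v w => H v w + H (psign v) (psign w)); split=> [w c u v|v w|v v_neq0|].
- by rewrite (linearP (@psign R M)) !H_lin scalerDr addrACA.
- by rewrite rmorphD /= -!H_herm.
- apply: ltr_wpDr; last exact: H_pos.
  apply/ltW/H_pos; apply: contraNneq v_neq0 => sv.
  by rewrite -[v]psignK sv (linear0 (@psign R M)).
move=> y y1 omy1 v w.
have psign_sact z u : parity true z -> psign (sact z u) = - act z u :> M.
  by move=> z1; rewrite (psign_act _ z1) psignK expr1 scaleN1r.
rewrite !psign_sact // (formNl H_lin) (formNr H_lin (fun v w => H_herm w v)) !H_inv.
by rewrite opprB addrC.
Qed.

Theorem theorem98 (R : realType) (G : cartanDatum R)
  (g : lieSuper R) (e : generators G g) (g_kac_moody : kac_moody e)
  (eps : 'I_(rank_ G) -> R[i]) (B : g -> g -> R[i])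
  (eps_sym : symmetrizer eps) (B_standard : standard_form e eps B)
  (B_real : real_on_simple_roots e B)
  (ph : {linear g -> cartan G}) (ph_proj : cartan_projection e ph)
  (rho rho0 : weight G) (rho_weyl : weyl_vector rho)
  (rho0_kp : kac_peterson e ph rho0)
  (gplus_abelian : abelian_set (gplus e))
  (gminus_abelian : abelian_set (gminus e))
  (g_compatible : compatible e)
  (J : choiceType) (x del : J -> g) (x_del_bases : dual_bases e B x del)
  (M : superModule g) (La : weight G) (vLa : M)
  (M_hw : highest_weight e setT setT La vLa)
  (M_decomposable : discretely_decomposable e M)
  (om : g -> g) (om_inv : anti_involution om) (om_consistent : consistent e om)
  (om_x_del : forall a, om (x a) = del a /\ om (del a) = x a)
  (La_real : real_weight e om La) (M_unitarizable : unitarizable om vLa)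
  (T : tensorProduct M (oscillator R J))
  (pi tau : g -> {linear T -> T}) (D d : {linear T -> T})
  (pi_def : oscillator_tensor_action B x del (extend0 ph (rho0 - rho)) pi)
  (tau_def : cochain_action B x del tau)
  (D_def : dirac_operator x del D) (d_def : coboundary del d) :
  kernel_iso_cohomology (extend0 ph (rho0 - rho)) pi tau D d.
Proof.
have [chev gen] := kac_moody_chevalley g_kac_moody.
have [t0 t0_sroot] := sroot_dual G.
have [l [l_gt0 del_deg x_deg l_fin]] := dual_degrees chev B_standard x_del_bases t0_sroot.
have [minus_stable plus_stable] : g0_stable (gminus e) /\ g0_stable (gplus e).
  by case: g_compatible.
have [K [K_lin K_herm K_pos K_adj]] := parity_averaged_form M_unitarizable.
have x_odd a : parity true (x a) by case: (x_gminus x_del_bases a).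
have del_odd a : parity true (del a) by case: (del_gplus x_del_bases a).
have XY a v w : K (sact (x a) v) w = - K v (sact (del a) w).
  by have [om_x _] := om_x_del a; rewrite (K_adj _ (x_odd a)) om_x.
have x_lowers k a v : hwdeg e vLa k v -> hwdeg e vLa (k + (l a)%:Z) (sact (x a) v).
  move=> kv; have := principal_lowers chev M_hw (x_deg a) (hwdeg_psign chev kv).
  by rewrite opprK.
have del_lowers k a v : hwdeg e vLa k v -> hwdeg e vLa (k - (l a)%:Z) (sact (del a) v).
  by move=> kv; apply: (principal_lowers chev M_hw (del_deg a) (hwdeg_psign chev kv)).
have del_supp (v : M) : exists A : {fset J}, forall a, a \notin A -> sact (del a) v = 0.
  pose S := [set v : M | exists A : {fset J}, forall a, a \notin A -> sact (del a) v = 0].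
  apply: (hwdeg_span chev gen M_hw (S := S)) => [|k u ku].
    split; first by exists fset0 => a _; rewrite linear0.
    move=> c u w [A hA] [A' hA']; exists (A `|` A')%fset => a.
    rewrite in_fsetU negb_or => /andP[/hA ua /hA' wa].
    by rewrite linearP /= ua wa scaler0 addr0.
  have [A hA] := l_fin `|k|%N; exists A => a /hA ka.
  apply: hwdeg_neg (del_lowers k a u ku); rewrite subr_lt0.
  by apply: le_lt_trans (ler_norm k) _; rewrite -abszE ltz_nat.
have YY a b (v : M) : sact (del a) (sact (del b) v) = - sact (del b) (sact (del a) v).
  rewrite /sact !(psign_act _ (del_odd _)) !psignK !actZr !expr1 !scaleN1r opprK.
  have := act_br v (del_odd a) (del_odd b).
  rewrite gplus_abelian; [|exact: del_gplus x_del_bases _|exact: del_gplus x_del_bases _].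
  rewrite act0l /= expr1 scaleN1r opprK => /esym/eqP; rewrite addr_eq0 => /eqP ->.
  by rewrite opprK.
have [f [f_bij f_eq]] := dirac_cohomology (O := oscillator_polynomials R J) (T := T)
  del_supp (dirac_sact D_def) (coboundary_sact d_def) YY K_lin K_herm K_pos XY l_gt0 l_fin
  (hwdeg_sub e vLa) (hwdeg_fin e vLa) (@hwdeg_neg _ _ _ e _ vLa)
  (hwdeg_span chev gen M_hw) x_lowers del_lowers.
have pi_tau z t := oscillator_tensor_actE chev B_standard x_del_bases minus_stable
  plus_stable t0_sroot pi_def tau_def t (z := z).
exists f; split=> // z t u z0 /f_eq [s ds].
have [zd zD] := cochain_act_commutes B_standard x_del_bases minus_stable plus_stable
  tau_def D_def d_def del_supp z0.
have Dt : D (pi z (ker_val t)) = 0.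
  rewrite pi_tau // linearB linearZ /= -zD.
  by have /eqP -> := ker_valP t; rewrite linear0 scaler0 subr0.
have du : d (tau z (ker_val u) - extend0 ph (rho0 - rho) z *: ker_val u) = 0.
  rewrite linearB linearZ /= -zd.
  by have /eqP -> := ker_valP u; rewrite linear0 scaler0 subr0.
exists (Kernel (introT eqP Dt : _ \in ker_pred D)).
exists (Kernel (introT eqP du : _ \in ker_pred d)); split=> //.
apply/f_eq; exists (tau z s - extend0 ph (rho0 - rho) z *: s) => /=.
rewrite pi_tau // linearB linearZ /= -zd ds linearB scalerBr.
by rewrite !opprD !opprK addrACA.
Qed.
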